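(* Let $1\le p\le q<\infty$, let $(\mathcal{F}_p,\Gamma_p,\Psi)$ be a $p$-energy structure on $(X,d,\mu)$, let $\Theta$ be a scale function and let $\nu$ be a Borel measure on $X$. Then the following two conditions are equivalent. (T1) There is a constant $K\ge1$ such that for all $x\in X$ and $r\in(0,\mathrm{diam}(X))$, $$\nu(B(x,r))^{\frac1q}\le K\,\Theta(x,r)\left(\frac{\mu(B(x,r))}{\Psi(x,r)}\right)^{\frac1p}.$$ (T2) There are constants $C,\sigma\ge1$ such that for all $x\in X$, $r\in(0,\mathrm{diam}(X))$ and $f\in\mathcal{F}_p$, $$\left(\int_{B(x,r)}|\tilde f-f_{B(x,r)}|^q\,d\nu\right)^{\frac1q}\le C\,\Theta(x,r)\left(\int_{B(x,\sigma r)}d\Gamma_p\langle f\rangle\right)^{\frac1p}.$$ Here $\tilde f$ is the precise representative of $f$, and the average $f_{B(x,r)}$ is taken with respect to $\mu$. The equivalence is quantitative: the constants in (T2) (resp. (T1)) depend only on the constants in (T1) (resp. (T2)), the constants appearing in $\mathrm{PI}_p(\Psi)$ and $\mathrm{Cap}_{p,\le}(\Psi)$, the doubling constant of $\mu$, the uniform perfectness constant of $(X,d)$, the constants associated with the scale functions $\Psi$ and $\Theta$, $p$ and $q$.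
   Context: Standing assumptions: $X$ is an infinite set, $(X,d)$ is a separable, locally compact metric space and $\mu$ is a Radon measure on it. $B(x,r)=\{y:d(x,y)<r\}$. $\mu$ is doubling: there is $D\ge1$ with $0<\mu(B(x,2r))\le D\mu(B(x,r))<\infty$ for all $x\in X$, $r>0$. $(X,d)$ is uniformly perfect: there is $\lambda\in(0,2]$ with $\mathrm{diam}(B(x,r))\ge\lambda r$ for all $x\in X$, $r\in(0,\mathrm{diam}(X))$, where $\mathrm{diam}(X)\in(0,\infty]$. Averages are always with respect to $\mu$: $f_A=\mu(A)^{-1}\int_Af\,d\mu$. For non-empty Borel sets $E\subseteq F\subseteq X$, a cutoff function for $E\subseteq F$ is a continuous $\varphi:X\to\mathbb{R}$ with $\varphi|_E=1$, $\varphi|_{X\setminus F}=0$, $0\le\varphi\le1$. A scale function is a function $\Psi:X\times(0,\infty)\to(0,\infty)$ for which there are $\beta_L,\beta_U>0$ and $C\ge1$ such that for all $x,y\in X$ and $0<r\le R<\infty$ with $B(y,r)\cap B(x,R)\ne\emptyset$, $C^{-1}(R/r)^{\beta_L}\le\Psi(x,R)/\Psi(y,r)\le C(R/r)^{\beta_U}$. A $p$-energy structure on $(X,d,\mu)$ is a triplet $(\mathcal{F}_p,\Gamma_p,\Psi)$ where $\mathcal{F}_p$ is a subset of $L^p(X,\mu)$ (no vector space structure assumed); $\Gamma_p$ assigns to every $f\in\mathcal{F}_p$ a non-negative finite Borel measure $\Gamma_p\langle f\rangle$ on $X$; and $\Psi$ is a scale function such that the following two conditions hold. $\mathrm{PI}_p(\Psi)$: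 there are $C,\sigma\ge1$ such that for all $x\in X$, $r>0$, $f\in\mathcal{F}_p$, $\int_{B(x,r)}|f-f_{B(x,r)}|^p\,d\mu\le C\Psi(x,r)\int_{B(x,\sigma r)}d\Gamma_p\langle f\rangle$. $\mathrm{Cap}_{p,\le}(\Psi)$: there are $C,\kappa>1$ such that for every $x\in X$ and $r\in(0,\mathrm{diam}(X))$ there is a cutoff function $\varphi\in\mathcal{F}_p$ for $B(x,r)\subseteq B(x,\kappa r)$ with $\int_Xd\Gamma_p\langle\varphi\rangle\le C\frac{\mu(B(x,r))}{\Psi(x,r)}$. The precise representative of $f\in\mathcal{F}_p$ is the Borel function $\tilde f:X\to[-\infty,\infty]$, $\tilde f(x):=\limsup_{i\to\infty}\sup\left\{\frac{1}{\mu(B(y,2^{-i}))}\int_{B(y,2^{-i})}f\,d\mu:\ y\in X,\ x\in B(y,2^{-i})\right\}$. *)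

(* Defs.v *)
From HB Require Import structures.
From mathcomp Require Import all_boot all_order all_algebra.
From mathcomp Require Import all_classical all_reals all_analysis.

Set Implicit Arguments.
Unset Strict Implicit.
Unset Printing Implicit Defensive.

Import Order.TTheory GRing.Theory Num.Theory.
Import numFieldNormedType.Exports.

Local Open Scope classical_set_scope.
Local Open Scope ring_scope.

(* A metric space carrying its Borel sigma-algebra. The base point that
   [Measurable] inherits from [Pointed] plays no role: any nonempty metric
   space can be given one. *)
HB.mixin Record isBorel (R : realType) (d : measure_display) T
    & Metric R T & Measurable d T := {
  borel_measurableE : (measurable : set (set T)) = <<s [set U : set T | open U] >>
}.

#[short(type="borelMetricType")]
HB.structure Definition BorelMetric (R : realType) (d : measure_display) :=
  {T of Metric R T & Measurable d T & isBorel R d T}.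

Section metric.
Context {R : realType} {X : metricType R}.
Implicit Types (A E F : set X) (Psi : X -> R -> R).

Definition separable (T : topologicalType) : Prop :=
  exists2 S : set T, countable S & dense S.

(* Only used for nonempty [A]; the diameter of [set0] is -oo here. *)
Definition diam A : \bar R :=
  ereal_sup [set (mdist y z)%:E | y in A & z in A].

Definition uniformly_perfect_with (lambda : R) : Prop :=
  0 < lambda <= 2 /\
  forall (x : X) (r : R), 0 < r -> (r%:E < diam [set: X])%E ->
    ((lambda * r)%:E <= diam (ball x r))%E.

(* A scale function is a map on X * (0, oo); the values of [Psi x r] for
   [r <= 0] are unconstrained and never used. *)
Definition scale_function_with (betaL betaU C : R) Psi : Prop :=
  [/\ 0 < betaL, 0 < betaU, 1 <= C,
      forall x r, 0 < r -> 0 < Psi x r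
    & forall x y r s, 0 < r -> r <= s -> ball y r `&` ball x s !=set0 ->
        C^-1 * (s / r) `^ betaL <= Psi x s / Psi y r <= C * (s / r) `^ betaU].

Definition scale_function Psi : Prop :=
  exists betaL betaU C, scale_function_with betaL betaU C Psi.

End metric.
Arguments uniformly_perfect_with {R} X lambda.

Definition uniformly_perfect (R : realType) (X : metricType R) : Prop :=
  exists lambda, uniformly_perfect_with X lambda.

Section borel_metric.
Context {R : realType} {d : measure_display} {X : borelMetricType R d}.
Implicit Types (mu nu : {measure set X -> \bar R}) (Psi Theta : X -> R -> R).

Definition radon_measure mu : Prop :=
  [/\ forall K : set X, compact K -> (mu K < +oo)%E,
      forall A : set X, measurable A ->
        mu A = ereal_inf [set mu U | U in [set U | open U /\ A `<=` U]]
    & forall U : set X, open U ->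
        mu U = ereal_sup [set mu K | K in [set K | compact K /\ K `<=` U]]].

Definition doubling_with (D : R) mu : Prop :=
  1 <= D /\
  forall (x : X) (r : R), 0 < r ->
    [/\ (0 < mu (ball x (2 * r)))%E,
        (mu (ball x (2 * r)) <= D%:E * mu (ball x r))%E
      & (D%:E * mu (ball x r) < +oo)%E].

Definition doubling mu : Prop := exists D, doubling_with D mu.

Definition standing_assumptions mu : Prop :=
  [/\ infinite_set [set: X], separable X, locally_compact [set: X]
    & radon_measure mu].

Definition cutoff_function (E F : set X) (phi : X -> R) : Prop :=
  [/\ [/\ E !=set0, measurable E, measurable F & E `<=` F],
      continuous phi,
      forall x, E x -> phi x = 1,
      forall x, ~ F x -> phi x = 0
    & forall x, 0 <= phi x <= 1].

Definition average mu (A : set X) (f : X -> R) : R :=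
  (fine (mu A))^-1 * \int[mu]_(y in A) f y.

Definition precise_representative mu (f : X -> R) (x : X) : \bar R :=
  limn_esup (fun i : nat =>
    ereal_sup [set (average mu (ball y (2^-1 ^+ i)) f)%:E
              | y in [set y : X | ball y (2^-1 ^+ i) x]]).

Section energy.
Context {mu : {measure set X -> \bar R}} {p : R} {p1 : (1 <= p%:E)%E}.
Local Notation Lp := (LspaceType mu p1).
Implicit Types (F : set Lp) (Gamma : Lp -> {finite_measure set X -> \bar R}).

Definition poincare_with (C sigma : R) F Gamma Psi : Prop :=
  [/\ 1 <= C, 1 <= sigma &
      forall (x : X) (r : R) (f : Lp), 0 < r -> F f ->
        (\int[mu]_(y in ball x r) (`|f y - average mu (ball x r) f| `^ p)%:E
          <= (C * Psi x r)%:E * Gamma f (ball x (sigma * r)))%E].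

(* [Lp] consists of classes modulo a.e. equality, so that "phi is in F" means
   that the class of phi is in F. *)
Definition capacity_upper_with (C kappa : R) F Gamma Psi : Prop :=
  [/\ 1 < C, 1 < kappa &
      forall (x : X) (r : R), 0 < r -> (r%:E < diam [set: X])%E ->
        exists (f : Lp) (phi : X -> R),
          [/\ F f, (f : X -> R) = phi %[ae mu],
              cutoff_function (ball x r) (ball x (kappa * r)) phi
            & (Gamma f [set: X] <= C%:E * (mu (ball x r) * (Psi x r)^-1%:E))%E]].

End energy.

(* [energy] matters only on [energy_dom]. *)
Record penergy_structure mu (p : R) (p1 : (1 <= p%:E)%E) := PEnergyStructure {
  energy_dom : set (LspaceType mu p1) ;
  energy : LspaceType mu p1 -> {finite_measure set X -> \bar R} ;
  energy_scale : X -> R -> R ;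
  energy_scaleP : scale_function energy_scale ;
  energy_poincare : exists C sigma,
    poincare_with C sigma energy_dom energy energy_scale ;
  energy_capacity : exists C kappa,
    capacity_upper_with C kappa energy_dom energy energy_scale
}.

Section trace.
Context {mu : {measure set X -> \bar R}} {p : R} {p1 : (1 <= p%:E)%E}.
Variables (S : penergy_structure mu p1) (q : R) (Theta : X -> R -> R).
Variable nu : {measure set X -> \bar R}.

Definition trace_measure_bound (K : R) : Prop :=
  forall (x : X) (r : R), 0 < r -> (r%:E < diam [set: X])%E ->
    ((nu (ball x r)) `^ q^-1 <=
      (K * Theta x r)%:E *
      (mu (ball x r) * (energy_scale S x r)^-1%:E) `^ p^-1)%E.

Definition trace_poincare (C sigma : R) : Prop :=
  forall (x : X) (r : R) (f : LspaceType mu p1),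
    0 < r -> (r%:E < diam [set: X])%E -> energy_dom S f ->
    ((\int[nu]_(y in ball x r)
        (`|precise_representative mu f y - (average mu (ball x r) f)%:E| `^ q))
       `^ q^-1 <=
      (C * Theta x r)%:E * (energy S f (ball x (sigma * r))) `^ p^-1)%E.

End trace.
End borel_metric.

(* Main.v *)
(* (T1) => (T2): for each k take a maximal (r/2^k)-separated set Z_k in B(x0,r),
   finite by doubling. Telescoping averages along balls B(z_k, 4r/2^k) with z_k
   in Z_k and d(z_k,x) < r/2^k, the Poincare inequality bounds
   |f~(x) - f_B(x0,r)| by a sum of oscillations e_k = (Psi Gamma / mu)^(1/p) of
   these balls. Since a sum of t^k c_k is at most sup c_k / (1 - t), and
   sup c_k^q <= sum c_k^q, the q-th power of this sum is controlled by
   sum_k (e_k / t^k)^q. Integrating against nu, (T1) turns nu(B) e_k^q into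
   Theta^q Gamma(B)^(q/p), where Theta supplies a factor beating t^(-kq); as
   q >= p and the balls of each scale overlap boundedly, the total energy is at
   most Gamma(B(x0,sigma r))^(q/p). No maximal function is needed.

   (T2) => (T1): test (T2) on B(z,r) with a cutoff function at the smaller scale
   delta r, where z runs over a (delta r)-net of B(x,r). Its precise
   representative is 1 on B(z, delta r), while by uniform perfectness B(z,r)
   contains a ball of comparable measure where the cutoff vanishes, so its average
   stays away from 1. Working with B(z,r), whose radius is smaller than diam X,
   avoids a separate treatment of radii close to the diameter. *)
Require Import Defs.
From mathcomp Require Import all_boot all_order all_algebra.
From mathcomp Require Import all_classical all_reals all_analysis.
From mathcomp Require Import measurable_realfun ring lra.
Set Implicit Arguments.
Unset Strict Implicit.
Unset Printing Implicit Defensive.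
Import Order.TTheory GRing.Theory Num.Theory.
Import numFieldNormedType.Exports.
Local Open Scope classical_set_scope.
Local Open Scope ring_scope.

(* Unlike [ge0_le_integral], no measurability: the integral of a nonnegative
   function is a supremum over simple functions below it, and this spares proving
   that the precise representative is measurable. *)
Lemma ge0_le_integralW d (T : measurableType d) (R : realType)
    (mu : {measure set T -> \bar R}) (D : set T) (f g : T -> \bar R) :
  (forall x, D x -> (0 <= f x)%E) -> (forall x, D x -> (f x <= g x)%E) ->
  (\int[mu]_(x in D) f x <= \int[mu]_(x in D) g x)%E.
Proof.
move=> f0 fg.
have g0 x : D x -> (0 <= g x)%E by move=> Dx; exact: le_trans (f0 _ Dx) (fg _ Dx).
rewrite !ge0_integralE//; apply: le_ereal_sup => _ [h hf <-]; exists h => // x.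
exact/(le_trans (hf x))/lee_restrict.
Qed.

(** The upper limit is an infimum of suprema over tails: every tail contains an index from [n] on,
    which gives the lower bound, and the tail starting at [n] gives the upper one. *)
Lemma limn_esup_itv (R : realType) (u : (\bar R)^nat) (a b : \bar R) (n : nat) :
  (forall i, (n <= i)%N -> (a <= u i <= b)%E) -> (a <= limn_esup u <= b)%E.
Proof.
move=> uab; apply/andP; split.
- rewrite /limn_esup limf_esupE; apply: le_ereal_inf_tmp => _ [V [m _ mV] <-].
  have /andP[/le_trans + _] := uab _ (leq_maxl n m); apply.
  by apply: ereal_sup_ubound; exists (maxn n m) => //; apply: mV => /=; exact: leq_maxr.
- rewrite /limn_esup limf_esupE.
  apply: (@le_trans _ _ (ereal_sup [set u x | x in [set i | (n <= i)%N]])).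
    by apply: ereal_inf_lbound; exists [set i | (n <= i)%N] => //; exists n.
  by apply: ge_ereal_sup => _ [i /= ni <-]; have /andP[] := uab _ ni.
Qed.

(** For [t > a], write [t] as the product of its powers [1 - p] and [p]; the first exponent is
    nonpositive, so its base may be lowered to [a]. *)
Lemma le_add_powR (R : realType) (a t p : R) : 0 < a -> 0 <= t -> 1 <= p ->
  t <= a + a `^ (1 - p) * t `^ p.
Proof.
move=> a0 t0 p1; have [ta|at_] := leP t a.
  by rewrite (le_trans ta)// lerDl mulr_ge0 ?powR_ge0.
have {}t0 : 0 < t by exact: lt_trans at_.
apply: (@le_trans _ _ (t `^ (1 - p) * t `^ p)).
  by rewrite -powRD ?(gt_eqF t0) ?implybT// subrK powRr1 ?(ltW t0).
rewrite -[leLHS]add0r lerD ?(ltW a0)// ler_wpM2r ?powR_ge0//.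
rewrite -(opprB p 1) !powRN lef_pV2 ?posrE ?powR_gt0//.
by rewrite ge0_ler_powR ?subr_ge0 ?nnegrE ?(ltW a0) ?(ltW t0) ?(ltW at_).
Qed.

(** * Averages over nested sets *)

Section average.
Context {R : realType} {d : measure_display} {X : borelMetricType R d}.
Implicit Types (mu : {measure set X -> \bar R}) (A B : set X) (f : X -> R).

(* Splitting the integrand by [le_add_powR] replaces Hölder's inequality. *)
Lemma average_sub_le mu A B f (c lam p : R) :
  measurable A -> measurable B -> A `<=` B -> measurable_fun setT f ->
  (0 < mu A)%E -> (mu B < +oo)%E -> 0 < lam -> 1 <= p ->
  (\int[mu]_(y in B) (`|f y - c| `^ p)%:E <= (lam `^ p * fine (mu B))%:E)%E ->
  `|average mu A f - c| <= 2 * lam * (fine (mu B) / fine (mu A)).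
Proof.
move=> mA mB AB mf A0 Boo lam0 p1 fB.
have muAB : (mu A <= mu B)%E by rewrite le_measure// inE.
have fA : mu A \is a fin_num by rewrite ge0_fin_numE// (le_lt_trans muAB).
have fBn : mu B \is a fin_num by rewrite ge0_fin_numE.
have a0 : 0 < fine (mu A) by rewrite fine_gt0// A0 -ge0_fin_numE.
have mfc D : measurable_fun D (fun y => f y - c).
  by apply: measurable_funB => //; exact: measurable_funTS.
have mabs D : measurable_fun D (fun y => `|f y - c|).
  by apply: measurableT_comp => //; exact: mfc.
have mpow D : measurable_fun D (fun y => `|f y - c| `^ p).
  by apply: (measurableT_comp (measurable_powR p)); exact: mabs.
(* With [a := lam] in [le_add_powR], each of the two summands integrates to at most [lam] times the
   measure of [B], hence the factor 2. *)
have intB : (\int[mu]_(y in B) (`|f y - c|)%:E <= (2 * lam * fine (mu B))%:E)%E.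
  apply: (@le_trans _ _ (\int[mu]_(y in B)
      (lam%:E + (lam `^ (1 - p))%:E * (`|f y - c| `^ p)%:E)))%E.
    apply: ge0_le_integralW => // y _.
    by rewrite -EFinM -EFinD lee_fin le_add_powR.
  rewrite ge0_integralD//; last 3 first.
  - by move=> y _; rewrite lee_fin ltW.
  - by move=> y _; rewrite mule_ge0// lee_fin ?powR_ge0.
  - by apply: measurable_funeM; exact/measurable_EFinP/mpow.
  rewrite integral_cst// ge0_integralZl//; last 2 first.
  - exact/measurable_EFinP/mpow.
  - by rewrite lee_fin powR_ge0.
  apply: (@le_trans _ _ (lam%:E * mu B +
      (lam `^ (1 - p))%:E * (lam `^ p * fine (mu B))%:E)%E).
    by rewrite leeD2l// lee_wpmul2l// lee_fin powR_ge0.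
  rewrite -{1}(fineK fBn) -!EFinM -EFinD lee_fin mulrA -powRD; last first.
    by rewrite (gt_eqF lam0) implybT.
  by rewrite subrK powRr1 ?(ltW lam0)// -mulrA mulr_natl mulr2n.
have intA : (\int[mu]_(y in A) (`|f y - c|)%:E <= (2 * lam * fine (mu B))%:E)%E.
  apply: le_trans intB; apply: ge0_subset_integral => //.
  exact/measurable_EFinP/mabs.
have ifc : mu.-integrable A (EFin \o (fun y => f y - c)).
  apply/integrableP; split; first exact/measurable_EFinP/mfc.
  by rewrite (le_lt_trans intA)// ltry.
have icst : mu.-integrable A (EFin \o (cst c : X -> R)).
  apply/integrableP; split; first exact/measurable_EFinP.
  under eq_integral do rewrite /=.
  by rewrite integral_cst// -(fineK fA) -EFinM ltry.
have -> : average mu A f - c = (fine (mu A))^-1 * \int[mu]_(y in A) (f y - c).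
  rewrite /average (_ : \int[mu]_(y in A) f y =
      \int[mu]_(y in A) (f y - c) + \int[mu]_(y in A) c).
    by rewrite Rintegral_cst// mulrDr mulrCA mulVf ?gt_eqF// mulr1 addrK.
  by rewrite -RintegralD//; apply: eq_Rintegral => y _; rewrite subrK.
rewrite normrM gtr0_norm ?invr_gt0// mulrA [leRHS]mulrC ler_pM2l ?invr_gt0//.
apply: le_trans (le_normr_Rintegral _ ifc) _ => //.
by rewrite -lee_fin /Rintegral fineK// ge0_fin_numE ?(le_lt_trans intA) ?ltry ?integral_ge0.
Qed.

End average.

(** * Doubling measures *)

Section separated.
Context {R : realType} {X : metricType R}.
Implicit Types (x y z : X) (r s t : R) (l : seq X).

Lemma mem_ball x r y : ball x r y = (mdist x y < r) :> Prop.
Proof. by rewrite ballEmdist. Qed.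

Lemma sub_ball x y r s : mdist y x + r <= s -> ball x r `<=` ball y s.
Proof.
move=> yxrs z; rewrite !mem_ball => xz.
by rewrite (le_lt_trans (metric_triangle _ x _))// (lt_le_trans _ yxrs)// ltrD2l.
Qed.

Lemma open_ball x r : open (ball x r).
Proof.
rewrite openE => y xy; apply/nbhs_ballP; exists (r - mdist x y) => /=.
  by rewrite subr_gt0 -mem_ball.
by apply: sub_ball; rewrite addrC subrK.
Qed.

Definition separated s l : Prop :=
  uniq l /\ {in l &, forall y z, y != z -> s <= mdist y z}.

Lemma separated_filter s l (P : pred X) : separated s l -> separated s [seq y <- l | P y].
Proof.
move=> [ul sl]; split; first exact: filter_uniq.
by move=> y z; rewrite !mem_filter => /andP[_ yl] /andP[_ zl]; exact: sl.
Qed.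

Lemma separated_cons s x l : 0 < s -> separated s l ->
  (forall z, z \in l -> ~ ball z s x) -> separated s (x :: l).
Proof.
move=> s0 [ul sl] xl; split=> /=.
  rewrite ul andbT; apply/negP => /xl; apply.
  by rewrite mem_ball mdistxx.
have {}xl z : z \in l -> s <= mdist z x.
  by move=> /xl; rewrite mem_ball => /negP; rewrite -leNgt.
move=> y z; rewrite !inE => /predU1P[->|yl] /predU1P[->|zl]; rewrite ?eqxx//.
- by move=> _; rewrite metric_sym xl.
- by move=> _; exact: xl.
- exact: sl.
Qed.

(** The bound [N] makes a list of maximal length exist; a point of [A] in none of its balls could be
    prepended to it. *)
Lemma maximal_separated_cover (A : set X) s (N : nat) : 0 < s ->
  (forall l, separated s l -> (forall z, z \in l -> A z) -> (size l <= N)%N) ->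
  exists l, [/\ separated s l, forall z, z \in l -> A z &
    forall y, A y -> exists2 z, z \in l & ball z s y].
Proof.
move=> s0 sN.
pose P n := `[< exists l, [/\ separated s l, forall z, z \in l -> A z & size l = n] >].
have P0 : exists n, P n by exists 0%N; apply/asboolP; exists nil; split.
have PN n : P n -> (n <= N)%N by move=> /asboolP[l [sl Al <-]]; exact: sN.
case: (ex_maxnP P0 PN) => n /asboolP[l [sl Al ln]] nmax.
exists l; split=> // y Ay; apply: contrapT => yl.
have : P n.+1.
  apply/asboolP; exists (y :: l); split => [||/=]; last by rewrite ln.
  - by apply: separated_cons => // z zl zy; apply: yl; exists z.
  - by move=> z; rewrite inE => /predU1P[->|/Al].
by move/nmax; rewrite ltnn.
Qed.

End separated.

(** Bounded overlap: on [B] the indicators of the sets add up to at most [N], and this is integrated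
    over [B]. *)
Lemma sum_measure_le d (T : measurableType d) (R : realType)
    (mu : {measure set T -> \bar R}) (I : eqType) (l : seq I) (F : I -> set T)
    (B : set T) (N : nat) : (forall i, measurable (F i)) -> measurable B ->
  (forall i, i \in l -> F i `<=` B) ->
  (forall y, B y -> (size [seq i <- l | `[< F i y >]] <= N)%N) ->
  (\sum_(i <- l) mu (F i) <= N%:R%:E * mu B)%E.
Proof.
move=> mF mB FB FN.
have -> : (\sum_(i <- l) mu (F i) = \sum_(i <- l) \int[mu]_(y in B) (\1_(F i) y)%:E)%E.
  apply: eq_big_seq => i il; rewrite integral_indic// (_ : F i `&` B = F i)//.
  exact/setIidPl/FB.
rewrite -ge0_integral_sum//; last first.
  by move=> i; apply/measurable_EFinP; exact: measurable_indic.
rewrite -integral_cst//; apply: ge0_le_integralW => y By.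
  by apply: sume_ge0.
rewrite sumEFin lee_fin /cst; have := FN _ By; rewrite -(ler_nat R).
apply: le_trans; rewrite size_filter -sum1_count natr_sum [leRHS]big_mkcond ler_sum// => i _.
by rewrite indicE; case: ifPn => [_|/asboolPn Fy]; [case: (_ \in _)|rewrite memNset].
Qed.

Lemma natr_le_truncn (R : realType) (n : nat) (a : R) : n%:R <= a -> (n <= Num.truncn a)%N.
Proof. by move=> na; rewrite truncn_ge_nat ?(le_trans _ na). Qed.

(** * Volume comparison, finite nets and bounded overlap *)

Section doubling.
Context {R : realType} {d : measure_display} {X : borelMetricType R d}.

Lemma measurable_ball (x : X) (r : R) : measurable (ball x r).
Proof.
by rewrite borel_measurableE; apply: sub_sigma_algebra; exact: open_ball.
Qed.

(** Real-valued, to allow field arithmetic. Since [fine] sends +oo to 0, it is the measure of the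
    ball only where that is finite: see [ball_volumeE] and [mu_ball]. *)
Definition ball_volume (nu : {measure set X -> \bar R}) (x : X) (r : R) : R :=
  fine (nu (ball x r)).

Lemma ball_volumeE (Gamma : {finite_measure set X -> \bar R}) x r :
  Gamma (ball x r) = (ball_volume Gamma x r)%:E.
Proof. by rewrite /ball_volume fineK// fin_num_measure//; exact: measurable_ball. Qed.

Lemma ball_volume_ge0 (nu : {measure set X -> \bar R}) x r : 0 <= ball_volume nu x r.
Proof. by rewrite fine_ge0. Qed.

Lemma ball_volume_le (Gamma : {finite_measure set X -> \bar R}) x y r s :
  ball x r `<=` ball y s -> ball_volume Gamma x r <= ball_volume Gamma y s.
Proof.
move=> xy; rewrite -lee_fin -!ball_volumeE.
by rewrite le_measure// inE; exact: measurable_ball.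
Qed.

Variables (mu : {measure set X -> \bar R}) (D : R).
Hypothesis muD : doubling_with D mu.
Local Notation vol := (ball_volume mu).

(** Finiteness comes from the doubling condition at radius [r / 2], which bounds the ball of radius
    [r] by a finite quantity. *)
Lemma mu_ball x r : 0 < r -> mu (ball x r) = (vol x r)%:E.
Proof.
move=> r0; rewrite /ball_volume fineK// ge0_fin_numE//.
have [D1 /(_ x (r / 2)) []] := muD; first by rewrite divr_gt0.
by rewrite mulrC divfK// => _ /le_lt_trans; apply.
Qed.

Lemma vol_gt0 x r : 0 < r -> 0 < vol x r.
Proof.
move=> r0; rewrite -lte_fin -mu_ball//.
have [D1 /(_ x (r / 2)) []] := muD; first by rewrite divr_gt0.
by rewrite mulrC divfK.
Qed.

Lemma vol_le x y r s : 0 < r -> 0 < s -> ball x r `<=` ball y s -> vol x r <= vol y s.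
Proof.
move=> r0 s0 xy; rewrite -lee_fin -!mu_ball//.
by rewrite le_measure// inE; exact: measurable_ball.
Qed.

Lemma vol_doubling n x r : 0 < r -> vol x (2 ^+ n * r) <= D ^+ n * vol x r.
Proof.
move=> r0; have [D1 dbl] := muD; elim: n => [|n ih]; first by rewrite !expr0 !mul1r.
have r1 : 0 < 2 ^+ n * r by rewrite mulr_gt0// exprn_gt0.
have [_ + _] := dbl x _ r1; rewrite !mulrA -exprS !mu_ball//; last first.
  by rewrite mulr_gt0// exprn_gt0.
rewrite -EFinM lee_fin => /le_trans; apply.
by rewrite exprS -mulrA ler_pM2l// (lt_le_trans ltr01).
Qed.

Lemma vol_comparable n x y r s : 0 < r -> 0 < s ->
  mdist y x + s <= 2 ^+ n * r -> vol x s <= D ^+ n * vol y r.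
Proof.
move=> r0 s0 xyrs; rewrite (le_trans _ (vol_doubling n y r0))//.
by apply: vol_le => //; [rewrite mulr_gt0// exprn_gt0|exact: sub_ball].
Qed.

(** The balls of radius [s / 2] about the points are disjoint, lie in [ball x (t + s / 2)], and by
    doubling each carries at least 1 / [D ^+ n] of its volume: the condition on [n] is
    [2 * t + s / 2 <= 2 ^+ n * (s / 2)]. *)
Lemma vol_separated_le (l : seq X) x s t n : 0 < s -> 0 < t -> 4 * t + s <= 2 ^+ n * s ->
  separated s l -> (forall z, z \in l -> ball x t z) -> (size l)%:R <= D ^+ n.
Proof.
move=> s0 t0 nst [ul sl] lt.
have s20 : 0 < s / 2 by rewrite divr_gt0.
have ts0 : 0 < t + s / 2 by rewrite addr_gt0.
have sub z : z \in l -> ball z (s / 2) `<=` ball x (t + s / 2).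
  by move=> /lt; rewrite mem_ball => xz; apply: sub_ball; rewrite lerD2r ltW.
have : (\sum_(z <- l) mu (ball z (s / 2)) <= 1%:R%:E * mu (ball x (t + s / 2)))%E.
  apply: sum_measure_le => //; try by move=> *; exact: measurable_ball.
  (* Two balls of radius [s / 2] meeting at [y] have centres closer than [s], so at most one of them
     contains [y]. *)
  move=> y _; set l' := seq.filter _ _.
  have ul' : uniq l' by exact: filter_uniq.
  have : {in l' &, forall a b, a = b}.
    move=> a b; rewrite !mem_filter => /andP[/asboolP + al] /andP[/asboolP + bl].
    rewrite !mem_ball => ay byy; apply/eqP/negPn/negP => /(sl _ _ al bl).
    apply/negP; rewrite -ltNge (le_lt_trans (metric_triangle _ y _))//.
    by rewrite [ltRHS]splitr ltrD// metric_sym.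
  case: l' ul' => [//|a [//|b l']] /= /andP[ab _] eqab.
  by move: ab; rewrite (eqab a b) ?inE ?eqxx ?orbT.
rewrite mul1e mu_ball// => volle.
have [D1 _] := muD; have D0 : 0 < D by exact: lt_le_trans D1.
rewrite -(ler_pM2r (vol_gt0 x ts0)).
have {volle} : \sum_(z <- l) vol z (s / 2) <= vol x (t + s / 2).
  rewrite -lee_fin -sumEFin (le_trans _ volle)//.
  by rewrite le_eqVlt; apply/orP; left; apply/eqP/eq_bigr => z _; rewrite mu_ball.
move=> volle; apply: le_trans (ler_wpM2l (ltW (exprn_gt0 n D0)) volle).
rewrite mulr_sumr -sum1_size natr_sum mulr_suml big_seq [leRHS]big_seq.
apply: ler_sum => z /lt; rewrite mem_ball mul1r => xz; apply: vol_comparable => //.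
rewrite metric_sym mulrA ler_pdivlMr// mulrDl mulrDl divfK// mulrC; lra.
Qed.

Lemma exists_net x t s n : 0 < s -> 0 < t -> 4 * t + s <= 2 ^+ n * s ->
  exists l : seq X, [/\ separated s l, forall z, z \in l -> ball x t z,
    forall y, ball x t y -> exists2 z, z \in l & ball z s y
    & (size l)%:R <= D ^+ n].
Proof.
move=> s0 t0 nst.
have [l|l [sl lt lc]] := @maximal_separated_cover _ X (ball x t) s
    (Num.truncn (D ^+ n)) s0.
  by move=> sl lt; apply/natr_le_truncn/(vol_separated_le s0 t0 nst sl lt).
by exists l; split=> //; exact: (vol_separated_le s0 t0 nst sl lt).
Qed.

(** A point lies in [ball z t] only for centres [z] within [t] of it, and [vol_separated_le] allows
    at most [D ^+ n] of these. Thus the overlap is bounded even when [t] exceeds the separation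
    [s]. *)
Lemma sum_ball_volume_le (Gamma : {finite_measure set X -> \bar R}) (l : seq X)
    x r s t n : 0 < s -> 0 < t -> 4 * t + s <= 2 ^+ n * s -> separated s l ->
  (forall z, z \in l -> ball x r z) ->
  \sum_(z <- l) ball_volume Gamma z t <= D ^+ n * ball_volume Gamma x (r + t).
Proof.
move=> s0 t0 nst sl lr.
have Dn0 : 0 <= D ^+ n.
  by have [D1 _] := muD; rewrite exprn_ge0// (le_trans ler01).
apply: (@le_trans _ _ ((Num.truncn (D ^+ n))%:R * ball_volume Gamma x (r + t))).
  rewrite -lee_fin -sumEFin EFinM -ball_volumeE.
  under eq_bigr do rewrite -ball_volumeE.
  apply: sum_measure_le; try by move=> *; exact: measurable_ball.
    move=> z /lr; rewrite mem_ball => xz; apply: sub_ball.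
    by rewrite lerD2r ltW.
  move=> y _; apply/natr_le_truncn/(@vol_separated_le _ y s t n).
  - by [].
  - by [].
  - by [].
  - exact: separated_filter.
  - by move=> z; rewrite mem_filter => /andP[/asboolP/ball_sym].
by rewrite ler_wpM2r ?ball_volume_ge0// Num.Theory.truncn_le.
Qed.

Lemma average_ball_sub_le x y s t n (f : X -> R) (p E : R) :
  0 < s -> 0 < t -> ball y s `<=` ball x t -> 2 * t <= 2 ^+ n * s ->
  measurable_fun setT f -> 1 <= p -> 0 <= E ->
  (\int[mu]_(u in ball x t) (`|f u - average mu (ball x t) f| `^ p)%:E
    <= (E `^ p * vol x t)%:E)%E ->
  `|average mu (ball y s) f - average mu (ball x t) f| <= 2 * D ^+ n * E.
Proof.
move=> s0 t0 yx nst mf p1 E0 fE.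
have D0 : 0 < D by have [D1 _] := muD; exact: lt_le_trans D1.
have Dn0 : 0 < D ^+ n by rewrite exprn_gt0.
have xy : mdist y x < t.
  by rewrite metric_sym -mem_ball; apply: yx; rewrite mem_ball mdistxx.
have vxy : vol x t / vol y s <= D ^+ n.
  rewrite ler_pdivrMr ?vol_gt0//; apply: vol_comparable => //.
  by rewrite (le_trans _ nst)// mulr_natl mulr2n lerD2r ltW.
(* [average_sub_le] needs a positive [lam], while [E] may vanish. The slack in [lam] is scaled so as
   to add exactly [e] to the final bound. *)
apply/ler_addgt0Pr => e e0.
pose lam := E + e / (2 * D ^+ n).
have e20 : 0 < e / (2 * D ^+ n) by rewrite divr_gt0// mulr_gt0.
have lam0 : 0 < lam by rewrite ltr_wpDl.
have := @average_sub_le _ _ _ mu (ball y s) (ball x t) f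
  (average mu (ball x t) f) lam p.
rewrite !mu_ball// lte_fin vol_gt0// ltry => /(_ _ _ yx mf isT isT lam0 p1 _).
have -> : 2 * D ^+ n * E + e = 2 * lam * D ^+ n.
  by rewrite /lam mulrDr mulrDl mulrAC; congr (_ + _); field; rewrite gt_eqF.
move=> h; apply: (le_trans (h _ _ _)); [exact: measurable_ball..| |].
  rewrite (le_trans fE)// lee_fin ler_wpM2r ?ball_volume_ge0//.
  apply: ge0_ler_powR; rewrite ?nnegrE ?(ltW lam0)// ?lerDl ?(ltW e20)//.
  exact: le_trans p1.
by rewrite ler_wpM2l// mulr_ge0 ?(ltW lam0).
Qed.

End doubling.

(** * From the measure bound to the Poincaré inequality *)

Section precise.
Context {R : realType} {d : measure_display} {X : borelMetricType R d}.
Variables (mu : {measure set X -> \bar R}) (f : X -> R) (x : X) (r c a : R).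
Hypothesis r0 : 0 < r.
Hypothesis fca : forall y s, 0 < s <= r -> ball y s x ->
  `|average mu (ball y s) f - c| <= a.

(** From some index on, the suprema in the upper limit run over balls of radius at most [r]
    containing [x]. An estimate uniform over such balls therefore passes to the limit, with no need
    for the averages to converge. *)
Lemma precise_representative_close :
  (`|precise_representative mu f x - c%:E| <= a%:E)%E.
Proof.
have half0 : 0 < (2^-1 : R) by [].
pose n := (Num.truncn r^-1).+1.
have nr i : (n <= i)%N -> 2^-1 ^+ i <= r.
  move=> ni; rewrite exprVn -[leRHS]invrK lef_pV2 ?posrE ?exprn_gt0 ?invr_gt0//.
  apply: (@le_trans _ _ n%:R); first by rewrite ltW// truncnS_gt.
  rewrite -natrX ler_nat (leq_trans (ltnW (ltn_expl n (ltnSn 1))))//.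
  by rewrite leq_exp2l.
have /andP[] : ((c - a)%:E <= precise_representative mu f x <= (c + a)%:E)%E.
  apply: (@limn_esup_itv _ _ _ _ n) => i /nr ir; apply/andP; split.
  - apply: (@le_trans _ _ (average mu (ball x (2^-1 ^+ i)) f)%:E).
      have := @fca x (2^-1 ^+ i); rewrite exprn_gt0// ir => /(_ isT).
      rewrite mem_ball mdistxx exprn_gt0// => /(_ isT).
      by rewrite ler_norml lee_fin => /andP[]; lra.
    apply: ereal_sup_ubound; exists x => //=.
    by rewrite mem_ball mdistxx exprn_gt0.
  - apply: ge_ereal_sup => _ [y /= yx <-].
    have := fca _ yx; rewrite exprn_gt0// ir => /(_ isT).
    by rewrite ler_norml lee_fin => /andP[]; lra.
case: (precise_representative _ _ _) => [u| |]//=.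
by rewrite !lee_fin ler_norml; lra.
Qed.

End precise.

(** * Telescoping averages along shrinking balls *)

Section chaining.
Context {R : realType} {d : measure_display} {X : borelMetricType R d}.
Variables (mu : {measure set X -> \bar R}) (D : R).
Hypothesis muD : doubling_with D mu.
Variables (p C sigma : R) (Psi : X -> R -> R) (f : X -> R).
Variable Gamma : {finite_measure set X -> \bar R}.
Hypotheses (p1 : 1 <= p) (C0 : 0 <= C) (Psi0 : forall x r, 0 < r -> 0 < Psi x r).
Hypothesis mf : measurable_fun setT f.
Hypothesis poincare : forall x r, 0 < r ->
  (\int[mu]_(y in ball x r) (`|f y - average mu (ball x r) f| `^ p)%:E
    <= (C * Psi x r)%:E * Gamma (ball x (sigma * r)))%E.

(** The bound that the Poincaré inequality gives for the p-mean deviation of [f] from its average on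
    [ball x r]; it depends on [f] only through the energy measure. *)
Definition oscillation x r : R :=
  (C * Psi x r * ball_volume Gamma x (sigma * r) / ball_volume mu x r) `^ p^-1.

(** The factor 8 covers every step of the chain below, the worst being from radius [4 * rad n] to a
    radius [s > rad n.+1]; then [2 * r <= 2 ^+ 4 * s] yields the power of [D]. *)
Lemma average_le_oscillation x y r s : 0 < r -> 0 < s ->
  ball y s `<=` ball x r -> r <= 8 * s ->
  `|average mu (ball y s) f - average mu (ball x r) f| <= 2 * D ^+ 4 * oscillation x r.
Proof.
move=> r0 s0 yx rs; apply: (average_ball_sub_le muD (p := p)) => //.
- by rewrite (_ : 2 ^+ 4 = 16); [lra|ring].
- exact: powR_ge0.
- rewrite (le_trans (poincare _ r0))// ball_volumeE -EFinM lee_fin.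
  have p0 : p != 0 by rewrite gt_eqF// (lt_le_trans ltr01).
  rewrite /oscillation -powRrM mulVf// powRr1 ?divfK ?gt_eqF ?(vol_gt0 muD)//.
  by rewrite divr_ge0 ?ball_volume_ge0// mulr_ge0 ?ball_volume_ge0// mulr_ge0// ltW// Psi0.
Qed.

Variables (x0 : X) (r theta : R) (Z : nat -> seq X).
Hypotheses (r0 : 0 < r) (theta0 : 0 < theta) (theta1 : theta < 1).
Local Notation rad k := (r / 2 ^+ k).
Hypothesis Zr : forall k z, z \in Z k -> ball x0 r z.
Hypothesis Zcover : forall k y, ball x0 r y -> exists2 z, z \in Z k & ball z (rad k) y.

(** The chain runs from [ball y s] to a net ball of comparable radius, then up through the scales to
    [ball x0 r], and its steps are bounded by a geometric series. Balls not centred at [x] are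
    allowed, as the precise representative demands. *)
Lemma chain_le x (M : R) : ball x0 r x -> 0 <= M ->
  (forall k z, z \in Z k -> ball z (rad k) x ->
    oscillation z (4 * rad k) <= theta ^+ k * M) ->
  forall y s, 0 < s <= r -> ball y s x ->
    `|average mu (ball y s) f - average mu (ball x0 r) f|
      <= 4 * D ^+ 4 / (1 - theta) * M.
Proof.
move=> x0x M0 oscM y s /andP[s0 sr] yx.
have rad0 k : 0 < rad k by rewrite divr_gt0// exprn_gt0.
have radS k : rad k = 2 * rad k.+1 by rewrite exprS; field; rewrite expf_neq0.
have [z zP] : {z : nat -> X & forall k, z k \in Z k /\ ball (z k) (rad k) x}.
  apply: (@choice _ _ (fun k z => z \in Z k /\ ball z (rad k) x)) => k.
  by have [z zZ zx] := Zcover k x0x; exists z.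
have zx k : mdist (z k) x < rad k by have [_] := zP k; rewrite mem_ball.
have x0z : mdist (z 0%N) x0 < r.
  by have [/Zr + _] := zP 0%N; rewrite mem_ball metric_sym.
have xy : mdist x y < s by rewrite metric_sym -mem_ball.
set av := average mu; set A := 2 * D ^+ 4.
have A0 : 0 <= A.
  by have [D1 _] := muD; rewrite mulr_ge0// exprn_ge0// (le_trans ler01).
have osck k : A * oscillation (z k) (4 * rad k) <= A * (theta ^+ k * M).
  by rewrite ler_wpM2l//; have [? ?] := zP k; exact: oscM.
have t1 : 0 < 1 - theta by rewrite subr_gt0.
(* The summand 1 pays for passing from [ball x0 r] to the ball about [z 0], the rest is the partial
   geometric sum. Consecutive centres are less than [3 * rad n.+1] apart, so the dilation by 4 makes
   the balls nested. *)
have step n : `|av (ball (z n) (4 * rad n)) f - av (ball x0 r) f|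
    <= A * M * (1 + (1 - theta ^+ n) / (1 - theta)).
  elim: n => [|n ih].
    rewrite !expr0 divr1 subrr mul0r addr0 mulr1 distrC.
    have := osck 0%N; rewrite !expr0 divr1 mul1r; apply: le_trans.
    by apply: average_le_oscillation; rewrite ?mulr_gt0//; [apply: sub_ball|]; lra.
  rewrite (le_trans (ler_distD (av (ball (z n) (4 * rad n)) f) _ _))//.
  have -> : A * M * (1 + (1 - theta ^+ n.+1) / (1 - theta)) =
      A * (theta ^+ n * M) + A * M * (1 + (1 - theta ^+ n) / (1 - theta)).
    by rewrite exprS; field; rewrite gt_eqF.
  apply: lerD => //; apply: le_trans (osck n).
  apply: average_le_oscillation; rewrite ?mulr_gt0//.
  - apply: sub_ball; have := metric_triangle (z n) x (z n.+1).
    have := zx n; have := zx n.+1; have := rad0 n.+1; rewrite (metric_sym (z n.+1)) (radS n).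
    by move: (rad n.+1) (mdist _ _) (mdist _ _) (mdist _ _) => *; lra.
  - by rewrite (radS n); have := rad0 n.+1; move: (rad n.+1) => *; lra.
(* The least index with radius below [s] is positive because [s <= r]; its predecessor is the scale
   sought. *)
have [n /andP[ns sn]] : exists n, rad n.+1 < s <= rad n.
  have ex : exists n, rad n < s.
    pose n := (Num.truncn (r / s)).+1; exists n.
    rewrite ltr_pdivrMr ?exprn_gt0// mulrC -ltr_pdivrMr//.
    rewrite (lt_le_trans (truncnS_gt _))// -natrX ler_nat.
    exact: (ltnW (ltn_expl n (ltnSn 1))).
  case: (ex_minnP ex) => -[|n] ns nmin; first by move: ns; rewrite expr0 divr1 ltNge sr.
  by exists n; rewrite ns/= leNgt; apply/negP => /nmin; rewrite ltnn.
have last : `|av (ball y s) f - av (ball (z n) (4 * rad n)) f| <= A * (theta ^+ n * M).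
  apply: le_trans (osck n); apply: average_le_oscillation; rewrite ?mulr_gt0//.
  - apply: sub_ball; have := metric_triangle (z n) x y; have := zx n; have := rad0 n.
    by move: (rad n) sn (mdist _ _) xy (mdist _ _) (mdist _ _) => *; lra.
  - by move: ns; rewrite (radS n); move: (rad n.+1) => *; lra.
rewrite (le_trans (ler_distD (av (ball (z n) (4 * rad n)) f) _ _))//.
rewrite (le_trans (lerD last (step n)))//.
(* The numerator [1 - theta + (1 - theta * theta ^+ n)] is less than 2, which turns the [2 * D ^+ 4]
   in [A] into [4 * D ^+ 4]. *)
have -> : A * (theta ^+ n * M) + A * M * (1 + (1 - theta ^+ n) / (1 - theta)) =
  A * M * (1 - theta + (1 - theta * theta ^+ n)) / (1 - theta).
  by field; rewrite gt_eqF.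
have -> : 4 * D ^+ 4 / (1 - theta) * M = A * M * 2 / (1 - theta).
  by rewrite /A; field; rewrite gt_eqF.
rewrite ler_pM2r ?invr_gt0// ler_wpM2l ?(mulr_ge0 A0 M0)//.
have := mulr_gt0 theta0 (exprn_gt0 n theta0); have := theta0.
by move: (theta * _) => u; lra.
Qed.

End chaining.

(** * Geometric series and real powers *)

Section series.
Context {R : realType}.

Lemma nneseries_geometric_le (u : nat -> \bar R) (a t : R) : 0 <= a -> 0 < t < 1 ->
  (forall k, (0 <= u k <= (a * t ^+ k)%:E)%E) ->
  (\sum_(0 <= k <oo) u k <= (a / (1 - t))%:E)%E.
Proof.
move=> a0 /andP[t0 t1] ua; apply: lime_le.
  by apply: is_cvg_nneseries => k _ _; have /andP[] := ua k.
apply: nearW => n; apply: (@le_trans _ _ (\sum_(0 <= k < n) (a * t ^+ k)%:E)%E).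
  by apply: lee_sum => k _; have /andP[] := ua k.
rewrite sumEFin lee_fin; apply: (@geometric_le_lim _ n a t) => //.
by rewrite gtr0_norm.
Qed.

(** Used with [s = q / p]: this is where [p <= q] enters, allowing powers of the energies of small
    balls to be summed as the energies themselves. *)
Lemma powR_le_mul (g G s : R) : 0 <= g -> g <= G -> 1 <= s ->
  g `^ s <= G `^ (s - 1) * g.
Proof.
move=> g0 gG s1; rewrite -mulr_powRB1//; last exact: lt_le_trans s1.
rewrite mulrC ler_wpM2r// ge0_ler_powR ?subr_ge0 ?nnegrE//.
exact: le_trans gG.
Qed.

Lemma powR_exprn (a s : R) k : 0 <= a -> (a ^+ k) `^ s = (a `^ s) ^+ k.
Proof. by move=> a0; rewrite -powR_mulrn// powRAC powR_mulrn// powR_ge0. Qed.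

Lemma powRVK (a s : R) : 0 <= a -> s != 0 -> (a `^ s) `^ s^-1 = a.
Proof. by move=> a0 s0; rewrite -powRrM mulfV// powRr1. Qed.

Lemma powRKV (a s : R) : 0 <= a -> s != 0 -> (a `^ s^-1) `^ s = a.
Proof. by move=> a0 s0; rewrite -powRrM mulVf// powRr1. Qed.

End series.

(** * Integrating the chain estimate against [nu] *)

Section measure_bound_to_poincare.
Context {R : realType} {d : measure_display} {X : borelMetricType R d}.
Variables (mu nu : {measure set X -> \bar R}) (D : R).
Hypothesis muD : doubling_with D mu.
Variables (p q C sigma K bL bU cPsi bL' bU' cTheta : R) (Psi Theta : X -> R -> R).
Variables (f : X -> R) (Gamma : {finite_measure set X -> \bar R}).
Hypotheses (p1 : 1 <= p) (pq : p <= q) (C1 : 1 <= C) (sigma1 : 1 <= sigma) (K1 : 1 <= K).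
Hypothesis PsiS : scale_function_with bL bU cPsi Psi.
Hypothesis ThetaS : scale_function_with bL' bU' cTheta Theta.
Hypothesis mf : measurable_fun setT f.
Hypothesis poincare : forall x r, 0 < r ->
  (\int[mu]_(y in ball x r) (`|f y - average mu (ball x r) f| `^ p)%:E
    <= (C * Psi x r)%:E * Gamma (ball x (sigma * r)))%E.
Hypothesis nu_bound : forall (x : X) (r : R), 0 < r -> (r%:E < diam [set: X])%E ->
  (nu (ball x r) `^ q^-1 <=
    (K * Theta x r)%:E * (mu (ball x r) * (Psi x r)^-1%:E) `^ p^-1)%E.

Local Notation osc := (oscillation mu p C sigma Psi Gamma).
Local Notation vol := (ball_volume mu).
Local Notation en := (ball_volume Gamma).

(* The ratio t of the header: since [Theta] decays at least like [decay ^+ (2 * k)]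
   at scale [2 ^- k], half of that decay remains after weighting by [decay ^- k]. *)
Definition decay : R := 2 `^ (- (bL' / 2)).

(** [K] comes from the measure bound, [cTheta] from [scale_decay], and the last factor from the
    Poincaré constant and the comparison of [Psi] at radii in ratio 4. *)
Definition local_constant : R := K * cTheta * (C * cPsi * 4 `^ bU) `^ p^-1.

Let q0 : 0 < q. Proof. by rewrite (lt_le_trans ltr01)// (le_trans p1). Qed.
Let p0 : 0 < p. Proof. exact: lt_le_trans p1. Qed.
Let Psi0 x r : 0 < r -> 0 < Psi x r. Proof. by case: PsiS => _ _ _ + _; exact. Qed.
Let Theta0 x r : 0 < r -> 0 < Theta x r. Proof. by case: ThetaS => _ _ _ + _; exact. Qed.
Let C0 : 0 <= C. Proof. exact: le_trans C1. Qed.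

Lemma decay_gt0 : 0 < decay. Proof. exact: powR_gt0. Qed.

Lemma decay_lt1 : decay < 1.
Proof.
have [b0 _ _ _ _] := ThetaS.
rewrite /decay powRN invf_lt1 ?powR_gt0//.
have := @gt0_ltr_powR _ (bL' / 2) _ 1 2; rewrite powR1; apply.
- by rewrite divr_gt0.
- by rewrite nnegrE.
- by rewrite nnegrE.
- by rewrite ltr1n.
Qed.

Lemma decay_powR_lt1 : decay `^ q < 1.
Proof.
have := gt0_ltr_powR q0 _ _ decay_lt1; rewrite powR1; apply; rewrite nnegrE//.
exact/ltW/decay_gt0.
Qed.

Lemma decay_sqr k : decay ^+ k * decay ^+ k * (2 ^+ k) `^ bL' = 1.
Proof.
rewrite powR_exprn// -!exprMn /decay -!powRD ?implybT// ?pnatr_eq0 ?implybT//.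
rewrite (_ : _ + _ = 0); first by rewrite powRr0 expr1n.
by field.
Qed.

(** This is the lower growth bound of [Theta] between the two radii, the power of [2 ^+ k] being
    rewritten by [decay_sqr]. *)
Lemma scale_decay x z r k : 0 < r -> ball x r z ->
  Theta z (r / 2 ^+ k) <= cTheta * (decay ^+ k * decay ^+ k) * Theta x r.
Proof.
move=> r0 xz; have [_ _ c1 _ +] := ThetaS.
have k0 : 0 < (2 ^+ k : R) by rewrite exprn_gt0.
have rk0 : 0 < r / 2 ^+ k by rewrite divr_gt0.
have c0 : 0 < cTheta by exact: lt_le_trans c1.
have Tz := Theta0 z rk0.
have rkr : r / 2 ^+ k <= r.
  by rewrite ler_pdivrMr// ler_peMr ?(ltW r0)// exprn_ege1// ler1n.
have zz : ball z (r / 2 ^+ k) `&` ball x r !=set0.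
  by exists z; split => //; rewrite mem_ball mdistxx.
move=> /(_ x z _ r rk0 rkr zz) /andP[+ _].
rewrite (_ : r / (r / 2 ^+ k) = 2 ^+ k); last first.
  by field; rewrite !gt_eqF.
rewrite ler_pdivlMr// => h.
have dk : 0 < decay ^+ k by rewrite exprn_gt0// decay_gt0.
have -> : Theta z (r / 2 ^+ k) = cTheta * (decay ^+ k * decay ^+ k) *
    (cTheta^-1 * (2 ^+ k) `^ bL' * Theta z (r / 2 ^+ k)).
  rewrite -[LHS]mul1r -[X in X * _ = _](decay_sqr k); by field; rewrite gt_eqF.
by rewrite ler_wpM2l// mulr_ge0 ?(ltW c0)// mulr_ge0 ?(ltW dk).
Qed.

(** In the product of the oscillation with the q-th root of the [nu]-measure, the volumes and the
    values of [Psi] cancel up to constants, leaving a power of the energy. Of the two factors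
    [decay ^+ k] supplied by [Theta], the weight consumes one and the other survives. *)
Lemma weighted_nu_le x z r k : 0 < r -> (r%:E < diam [set: X])%E -> ball x r z ->
  (((osc z (4 * (r / 2 ^+ k)) / decay ^+ k) `^ q)%:E * nu (ball z (r / 2 ^+ k))
    <= ((local_constant * Theta x r) `^ q * (decay `^ q) ^+ k *
        en z (sigma * (4 * (r / 2 ^+ k))) `^ (q / p))%:E)%E.
Proof.
move=> r0 rX xz; set rho := r / 2 ^+ k; set w := _ / _; set g := en _ _.
have [_ _ cT1 _ _] := ThetaS; have [_ bU0 cP1 _ PsiC] := PsiS.
have [K0 cT0] : 0 <= K /\ 0 <= cTheta by split; exact: (le_trans ler01).
have rho0 : 0 < rho by rewrite divr_gt0// exprn_gt0.
have rho4 : 0 < 4 * rho by rewrite mulr_gt0.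
have rhor : rho <= r by rewrite ler_pdivrMr// ler_peMr ?(ltW r0)// exprn_ege1// ler1n.
have dk0 : 0 < decay ^+ k by rewrite exprn_gt0// decay_gt0.
have rhoX : (rho%:E < diam [set: X])%E by rewrite (le_lt_trans _ rX)// lee_fin.
have := nu_bound z rho0 rhoX.
have vr0 : 0 < vol z rho by exact: (vol_gt0 muD).
have v40 : 0 < vol z (4 * rho) by exact: (vol_gt0 muD).
have Pr0 : 0 < Psi z rho by exact: Psi0.
have P40 : 0 < Psi z (4 * rho) by exact: Psi0.
have Tr0 : 0 < Theta z rho by exact: Theta0.
have Tx0 : 0 < Theta x r by exact: Theta0.
have g0 : 0 <= g by exact: ball_volume_ge0.
have w0 : 0 <= w by rewrite divr_ge0 ?powR_ge0 ?(ltW dk0).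
rewrite (mu_ball muD z rho0).
rewrite -(EFinM (vol z rho)) poweR_EFin -(EFinM (K * _)) => nuz.
(* A finite q-th root excludes infinite measure, so the rest is real arithmetic. *)
have nufin : nu (ball z rho) \is a fin_num.
  rewrite ge0_fin_numE// (@lty_poweRy _ _ q^-1) ?invr_neq0 ?gt_eqF//.
  by rewrite (le_lt_trans nuz)// ltry.
move: nuz; rewrite -(fineK nufin) poweR_EFin lee_fin -EFinM lee_fin.
set v := fine _ => nuz.
have v0 : 0 <= v by exact: fine_ge0.
rewrite -[in leLHS](@powRKV _ v q) ?gt_eqF// -powRM ?powR_ge0//.
have A0 : 0 <= C * Psi z (4 * rho) * g / vol z (4 * rho).
  by rewrite divr_ge0 ?(ltW v40)// mulr_ge0// mulr_ge0// ltW.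
have B0 : 0 <= vol z rho / Psi z rho by rewrite divr_ge0 ?ltW.
have P4 : Psi z (4 * rho) / Psi z rho <= cPsi * 4 `^ bU.
  have rho14 : rho <= 4 * rho by lra.
  have zz : ball z rho `&` ball z (4 * rho) !=set0.
    by exists z; split; rewrite mem_ball mdistxx.
  have /andP[_] := PsiC z z rho _ rho0 rho14 zz.
  by rewrite mulfK ?gt_eqF.
have v4 : vol z rho / vol z (4 * rho) <= 1.
  rewrite ler_pdivrMr// mul1r.
  by apply: (vol_le muD) => //; apply: sub_ball; rewrite mdistxx; lra.
have AB : osc z (4 * rho) * (vol z rho / Psi z rho) `^ p^-1 <=
    (C * cPsi * 4 `^ bU) `^ p^-1 * g `^ p^-1.
  have cC0 : 0 <= C * cPsi * 4 `^ bU.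
    by rewrite mulr_ge0 ?powR_ge0// mulr_ge0// (le_trans ler01).
  rewrite /oscillation -/g -!powRM//.
  apply: ge0_ler_powR;
    rewrite ?nnegrE ?invr_ge0 ?(ltW p0) ?(mulr_ge0 A0 B0) ?(mulr_ge0 cC0 g0)//.
  have -> : C * Psi z (4 * rho) * g / vol z (4 * rho) * (vol z rho / Psi z rho) =
      C * g * (Psi z (4 * rho) / Psi z rho * (vol z rho / vol z (4 * rho))).
    by field; rewrite !gt_eqF.
  rewrite -[leRHS]mulr1 [leRHS](_ : _ = C * g * (cPsi * 4 `^ bU * 1)); last by ring.
  by rewrite ler_wpM2l ?mulr_ge0// ler_pM// divr_ge0// ltW.
have wv : w * v `^ q^-1 <= decay ^+ k * (local_constant * Theta x r) * g `^ p^-1.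
  rewrite /w mulrAC ler_pdivrMr//.
  apply: (@le_trans _ _ (osc z (4 * rho) *
      (K * (cTheta * (decay ^+ k * decay ^+ k) * Theta x r) *
       (vol z rho / Psi z rho) `^ p^-1))).
    rewrite ler_wpM2l ?powR_ge0// (le_trans nuz)// ler_wpM2r ?powR_ge0//.
    by rewrite ler_wpM2l ?(le_trans ler01)//; exact: scale_decay.
  rewrite mulrCA; apply: (le_trans (ler_wpM2l _ AB)).
    by rewrite !mulr_ge0 ?(ltW dk0) ?(ltW Tx0).
  by rewrite /local_constant le_eqVlt; apply/orP; left; apply/eqP; ring.
have LC0 : 0 <= local_constant * Theta x r.
  by rewrite /local_constant !mulr_ge0 ?powR_ge0 ?(ltW Tx0).
apply: (le_trans (ge0_ler_powR _ _ _ wv)).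
- exact: ltW.
- by rewrite nnegrE mulr_ge0 ?powR_ge0.
- by rewrite nnegrE (mulr_ge0 (mulr_ge0 (ltW dk0) LC0))// powR_ge0.
rewrite powRM ?powR_ge0 ?(mulr_ge0 (ltW dk0) LC0)//.
rewrite (powRM _ (ltW dk0))// powR_exprn ?(ltW decay_gt0)//.
by rewrite -powRrM [p^-1 * _]mulrC [decay `^ q ^+ k * _]mulrC.
Qed.

(** One factor of each power [q / p] of the energy is summed by bounded overlap, the others are
    bounded by the energy of the large ball. The condition on [n] is that of [sum_ball_volume_le]
    for radius [4 * sigma] times the separation. *)
Lemma sum_weighted_nu_le x r k n (l : seq X) : 0 < r -> (r%:E < diam [set: X])%E ->
  16 * sigma + 1 <= 2 ^+ n ->
  separated (r / 2 ^+ k) l -> (forall z, z \in l -> ball x r z) ->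
  (\sum_(z <- l) ((osc z (4 * (r / 2 ^+ k)) / decay ^+ k) `^ q)%:E * nu (ball z (r / 2 ^+ k))
    <= ((local_constant * Theta x r) `^ q * D ^+ n *
        en x ((1 + 4 * sigma) * r) `^ (q / p) * (decay `^ q) ^+ k)%:E)%E.
Proof.
move=> r0 rX nsigma; set rho := r / 2 ^+ k => sl lx.
have rho0 : 0 < rho by rewrite divr_gt0// exprn_gt0.
have rhor : rho <= r by rewrite ler_pdivrMr// ler_peMr ?(ltW r0)// exprn_ege1// ler1n.
have sigma0 : 0 < sigma by exact: lt_le_trans sigma1.
have t0 : 0 < sigma * (4 * rho) by rewrite !mulr_gt0.
have sr : sigma * (4 * rho) <= 4 * sigma * r.
  by rewrite mulrA [sigma * 4]mulrC ler_wpM2l// mulr_ge0// ltW.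
have dq0 : 0 <= decay `^ q by exact: powR_ge0.
set G := en x _.
have sG : \sum_(z <- l) en z (sigma * (4 * rho)) <= D ^+ n * G.
  apply: (le_trans (sum_ball_volume_le muD (n := n) Gamma rho0 t0 _ sl lx)).
    rewrite (_ : _ + _ = (16 * sigma + 1) * rho); last by ring.
    by rewrite ler_wpM2r// ltW.
  rewrite ler_wpM2l ?exprn_ge0//.
    by have [D1 _] := muD; rewrite (le_trans ler01).
  by apply: ball_volume_le; apply: sub_ball; rewrite mdistxx; lra.
apply: (@le_trans _ _ (\sum_(z <- l) ((local_constant * Theta x r) `^ q *
    (decay `^ q) ^+ k * (G `^ (q / p - 1) * en z (sigma * (4 * rho))))%:E)%E).
  rewrite big_seq [leRHS]big_seq; apply: lee_sum => z /lx xz.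
  rewrite (le_trans (weighted_nu_le k r0 rX xz))// lee_fin ler_wpM2l//.
    by rewrite mulr_ge0 ?powR_ge0 ?exprn_ge0.
  apply: powR_le_mul; first exact: ball_volume_ge0.
    apply: ball_volume_le; apply: sub_ball; move: xz; rewrite mem_ball -/rho => xz.
    by lra.
  by rewrite ler_pdivlMr// mul1r.
rewrite sumEFin lee_fin -!mulr_sumr.
rewrite [leRHS](_ : _ = (local_constant * Theta x r) `^ q * decay `^ q ^+ k *
    (D ^+ n * G `^ (q / p))); last by ring.
rewrite ler_wpM2l ?mulr_ge0 ?powR_ge0 ?exprn_ge0//.
rewrite -(mulr_powRB1 (p := q / p)) ?ball_volume_ge0 ?divr_gt0//.
by rewrite mulrA [leRHS]mulrC ler_wpM2l ?powR_ge0.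
Qed.

(** The factors come from the chain of averages, from a single net ball, and from the overlap
    together with the geometric series over scales. *)
Definition trace_constant (n : nat) : R :=
  4 * D ^+ 4 / (1 - decay) * local_constant * (D ^+ n / (1 - decay `^ q)) `^ q^-1.

Section potential.
Variables (x0 : X) (r : R) (Z : nat -> seq X).
Hypotheses (r0 : 0 < r) (rX : (r%:E < diam [set: X])%E).
Hypothesis Zsep : forall k, separated (r / 2 ^+ k) (Z k).
Hypothesis Zr : forall k z, z \in Z k -> ball x0 r z.
Hypothesis Zcover : forall k y, ball x0 r y ->
  exists2 z, z \in Z k & ball z (r / 2 ^+ k) y.

(** Summing over all net balls containing [x], rather than one chosen per scale, makes this
    measurable in [x] and integrable term by term. It may be infinite. *)
Definition potential (x : X) : \bar R :=
  (\sum_(0 <= k <oo) \sum_(z <- Z k)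
    ((osc z (4 * (r / 2 ^+ k)) / decay ^+ k) `^ q)%:E * (\1_(ball z (r / 2 ^+ k)) x)%:E)%E.

Let term_ge0 k x : (0 <= \sum_(z <- Z k)
  ((osc z (4 * (r / 2 ^+ k)) / decay ^+ k) `^ q)%:E * (\1_(ball z (r / 2 ^+ k)) x)%:E)%E.
Proof. by apply: sume_ge0 => z _; rewrite mule_ge0// lee_fin ?powR_ge0. Qed.

Lemma potential_ge0 x : (0 <= potential x)%E.
Proof. exact: nneseries_ge0. Qed.

Let measurable_term k z : measurable_fun (ball x0 r) (fun x =>
  ((osc z (4 * (r / 2 ^+ k)) / decay ^+ k) `^ q)%:E * (\1_(ball z (r / 2 ^+ k)) x)%:E)%E.
Proof.
apply: measurable_funeM; apply/measurable_EFinP; apply: measurable_indic.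
exact: measurable_ball.
Qed.

Lemma measurable_potential : measurable_fun (ball x0 r) potential.
Proof.
apply: ge0_emeasurable_sum => [k x _ _|k _]; first exact: term_ge0.
exact: emeasurable_sum.
Qed.

(** A single term of a nonnegative series is at most its sum; taking q-th roots gives the geometric
    hypothesis of [chain_le]. *)
Lemma oscillation_le_potential x (g : R) : potential x = g%:E ->
  forall k z, z \in Z k -> ball z (r / 2 ^+ k) x ->
    osc z (4 * (r / 2 ^+ k)) <= decay ^+ k * g `^ q^-1.
Proof.
move=> xg k z zk zx.
have dk0 : 0 < decay ^+ k by rewrite exprn_gt0// decay_gt0.
rewrite [leRHS]mulrC -ler_pdivrMr//; set w := _ / _.
have w0 : 0 <= w by rewrite divr_ge0 ?powR_ge0 ?(ltW dk0).
have wg : w `^ q <= g.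
  rewrite -lee_fin -xg; apply: (le_trans _ (nneseries_lim_ge k.+1 _)) => //.
  rewrite big_nat_recr//= -[leLHS]add0e leeD//; first exact: sume_ge0.
  rewrite (big_rem z)//= -[leLHS]adde0 leeD//.
    by rewrite indicE mem_set// mule1.
  by apply: sume_ge0 => y _; rewrite mule_ge0// lee_fin ?powR_ge0.
rewrite -[leLHS](@powRVK _ w q) ?gt_eqF//.
by apply: ge0_ler_powR; rewrite ?nnegrE ?invr_ge0 ?(ltW q0)// ?powR_ge0 ?(le_trans _ wg) ?powR_ge0.
Qed.

Lemma deviation_le_potential x : ball x0 r x ->
  (`|precise_representative mu f x - (average mu (ball x0 r) f)%:E| `^ q
   <= ((4 * D ^+ 4 / (1 - decay)) `^ q)%:E * potential x)%E.
Proof.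
move=> x0x; set H := 4 * _ / _.
have [D1 _] := muD.
have H0 : 0 < H.
  by rewrite divr_gt0 ?subr_gt0 ?decay_lt1// mulr_gt0// exprn_gt0// (lt_le_trans ltr01).
(* If the potential is infinite, so is the right-hand side, its coefficient being positive. *)
case E : (potential x) (potential_ge0 x) => [g| |//]; last first.
  by rewrite gt0_muley ?leey// lte_fin powR_gt0.
rewrite lee_fin => g0.
have a0 : 0 <= g `^ q^-1 by exact: powR_ge0.
have := precise_representative_close r0 (chain_le muD p1 C0 Psi0 mf poincare r0
  decay_gt0 decay_lt1 Zr Zcover x0x a0 (oscillation_le_potential E)).
rewrite -/H => h.
have -> : ((H `^ q)%:E * g%:E = (H * g `^ q^-1)%:E `^ q)%E.
  by rewrite poweR_EFin (powRM _ (ltW H0) a0) powRKV ?gt_eqF// EFinM.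
apply: gt0_ler_poweR => //; first exact: ltW.
  by rewrite in_itv/= abse_ge0 leey.
by rewrite in_itv/= leey lee_fin mulr_ge0// ltW.
Qed.

(** Integration term by term reduces to [sum_weighted_nu_le] at each scale; these bounds form a
    geometric series of ratio the q-th power of [decay]. *)
Lemma integral_potential_le n : 16 * sigma + 1 <= 2 ^+ n ->
  (\int[nu]_(x in ball x0 r) potential x <=
    ((local_constant * Theta x0 r) `^ q * D ^+ n *
        en x0 ((1 + 4 * sigma) * r) `^ (q / p) / (1 - decay `^ q))%:E)%E.
Proof.
move=> nsigma; have [D1 _] := muD.
rewrite integral_nneseries//; last 2 first.
- exact: measurable_ball.
- by move=> k; apply: emeasurable_sum => z.
apply: nneseries_geometric_le.
- by rewrite !mulr_ge0 ?powR_ge0// exprn_ge0// (le_trans ler01).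
- by rewrite powR_gt0 ?decay_gt0//= decay_powR_lt1.
move=> k; rewrite integral_ge0//=.
apply: le_trans (sum_weighted_nu_le r0 rX nsigma (Zsep k) (Zr (k := k))).
rewrite ge0_integral_sum//; last 2 first.
- exact: measurable_ball.
- by move=> z x _; rewrite mule_ge0// lee_fin ?powR_ge0.
apply: lee_sum => z _.
rewrite ge0_integralZl_EFin ?powR_ge0//; last 2 first.
- exact: measurable_ball.
- by apply/measurable_EFinP; apply: measurable_indic; exact: measurable_ball.
rewrite lee_wpmul2l ?lee_fin ?powR_ge0// integral_indic; try exact: measurable_ball.
apply: le_measure; rewrite ?inE; last exact: subIsetl.
- by apply: measurableI; exact: measurable_ball.
- exact: measurable_ball.
Qed.

End potential.

Lemma trace_poincare_of_measure_bound x r n : 0 < r -> (r%:E < diam [set: X])%E ->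
  16 * sigma + 1 <= 2 ^+ n ->
  ((\int[nu]_(y in ball x r)
      (`|precise_representative mu f y - (average mu (ball x r) f)%:E| `^ q)) `^ q^-1
   <= (trace_constant n * Theta x r)%:E * Gamma (ball x ((1 + 4 * sigma) * r)) `^ p^-1)%E.
Proof.
move=> r0 rX nsigma; have [D1 _] := muD.
have [Z Zk] : {Z : nat -> seq X & forall k, [/\ separated (r / 2 ^+ k) (Z k),
    forall z, z \in Z k -> ball x r z &
    forall y, ball x r y -> exists2 z, z \in Z k & ball z (r / 2 ^+ k) y]}.
  apply: (@choice _ _ (fun k (l : seq X) => [/\ separated (r / 2 ^+ k) l,
    forall z, z \in l -> ball x r z &
    forall y, ball x r y -> exists2 z, z \in l & ball z (r / 2 ^+ k) y])) => k.
  have rk0 : 0 < r / 2 ^+ k by rewrite divr_gt0// exprn_gt0.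
  (* With exponent [k.+3] the condition reads [4 * r + r / 2 ^+ k <= 8 * r]. The cardinality bound
     grows with [k] and is dropped: only finiteness and separation matter. *)
  have [|l [? ? ? _]] := exists_net muD (n := k.+3) x rk0 r0; last by exists l.
  rewrite !exprS !mulrA [leRHS](_ : _ = 8 * r); last by field; rewrite expf_neq0.
  have : r / 2 ^+ k <= r.
    by rewrite ler_pdivrMr// ler_peMr ?(ltW r0)// exprn_ege1// ler1n.
  by move: (_ / _) => u; lra.
have Zsep k : separated (r / 2 ^+ k) (Z k) by have [] := Zk k.
have Zr k z : z \in Z k -> ball x r z by have [_ + _] := Zk k; exact.
have Zcover k y : ball x r y -> exists2 z, z \in Z k & ball z (r / 2 ^+ k) y.
  by have [_ _] := Zk k; exact.
have H0 : 0 <= 4 * D ^+ 4 / (1 - decay).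
  rewrite divr_ge0 ?subr_ge0 ?(ltW decay_lt1)// mulr_ge0// exprn_ge0//.
  exact: le_trans D1.
have t1 : 0 <= 1 - decay `^ q by rewrite subr_ge0 ltW// decay_powR_lt1.
have LC0 : 0 <= local_constant * Theta x r.
  have [_ _ cT1 _ _] := ThetaS; have T0 := Theta0 x r0.
  by rewrite /local_constant !mulr_ge0 ?powR_ge0 ?(ltW T0)// (le_trans ler01).
have Dn0 : 0 <= D ^+ n by rewrite exprn_ge0// (le_trans ler01).
set G := en x ((1 + 4 * sigma) * r).
have G0 : 0 <= G by exact: ball_volume_ge0.
rewrite ball_volumeE -/G poweR_EFin -EFinM.
set J := ((local_constant * Theta x r) `^ q * D ^+ n * G `^ (q / p) / (1 - decay `^ q)).
have J0 : 0 <= J by rewrite /J divr_ge0// !mulr_ge0 ?powR_ge0.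
set I := integral _ _ _.
have I0 : (0 <= I)%E by apply: integral_ge0 => y _; exact: poweR_ge0.
have IJ : (I <= ((4 * D ^+ 4 / (1 - decay)) `^ q * J)%:E)%E.
  apply: (@le_trans _ _ (\int[nu]_(y in ball x r)
      (((4 * D ^+ 4 / (1 - decay)) `^ q)%:E * potential r Z y))%E).
    apply: ge0_le_integralW => y; first by move=> _; exact: poweR_ge0.
    exact: deviation_le_potential.
  rewrite ge0_integralZl_EFin ?powR_ge0//; last 3 first.
  - exact: measurable_ball.
  - by move=> y _; exact: potential_ge0.
  - exact: measurable_potential.
  by rewrite EFinM lee_wpmul2l ?lee_fin ?powR_ge0//; exact: integral_potential_le.
apply: (@le_trans _ _ (((4 * D ^+ 4 / (1 - decay)) `^ q * J)%:E `^ q^-1)%E).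
  apply: gt0_ler_poweR => //; first by rewrite invr_ge0 ltW.
    by rewrite in_itv/= I0 leey.
  by rewrite in_itv/= leey lee_fin mulr_ge0 ?powR_ge0.
rewrite poweR_EFin lee_fin powRM ?powR_ge0// powRVK ?gt_eqF//.
set b := local_constant * Theta x r in LC0 J J0 IJ *.
set e := D ^+ n / (1 - decay `^ q).
have e0 : 0 <= e by rewrite divr_ge0.
have -> : J = b `^ q * e * G `^ (q / p) by rewrite /J /e; ring.
rewrite (powRM _ (mulr_ge0 (powR_ge0 _ _) e0) (powR_ge0 _ _)) (powRM _ (powR_ge0 _ _) e0).
rewrite powRVK ?gt_eqF// -powRrM (_ : q / p / q = p^-1); last by field; rewrite !gt_eqF.
by rewrite /trace_constant -/e le_eqVlt; apply/orP; left; apply/eqP; rewrite /b; ring.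
Qed.

End measure_bound_to_poincare.

(** * From the Poincaré inequality to the measure bound *)

(** The sum of the indicators is at least 1 on [A]; integrate it. *)
Lemma measure_le_sum d (T : measurableType d) (R : realType)
    (mu : {measure set T -> \bar R}) (I : eqType) (l : seq I) (F : I -> set T)
    (A : set T) : (forall i, measurable (F i)) -> measurable A ->
  (forall y, A y -> exists2 i, i \in l & F i y) ->
  (mu A <= \sum_(i <- l) mu (F i))%E.
Proof.
move=> mF mA AF; rewrite -[leLHS]mul1e -integral_cst//.
apply: (@le_trans _ _ (\int[mu]_(y in A) \sum_(i <- l) (\1_(F i) y)%:E)%E).
  apply: ge0_le_integralW => y Ay; first by rewrite lee_fin.
  have [i il Fy] := AF y Ay; rewrite (big_rem i)//= -[leLHS]adde0 leeD//.
    by rewrite indicE mem_set.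
  exact: sume_ge0.
rewrite ge0_integral_sum//; last first.
  by move=> i; apply/measurable_EFinP; exact: measurable_indic.
apply: lee_sum => i _; rewrite integral_indic//.
by apply: le_measure; rewrite ?inE//; exact: measurableI.
Qed.

Section uniformly_perfect.
Context {R : realType} {X : metricType R} {lambda : R}.
Hypothesis Xlambda : uniformly_perfect_with X lambda.

(** The ball of radius [r / 2] has diameter at least [lambda * r / 2], so it holds two points more
    than [2 * (lambda * r / 5)] apart, and one of these is far from [x]. *)
Lemma exists_far_point (x : X) r : 0 < r -> (r%:E < diam [set: X])%E ->
  exists w, lambda * r / 5 < mdist x w < r / 2.
Proof.
move=> r0 rX; have [/andP[l0 l2] perf] := Xlambda.
have r20 : 0 < r / 2 by rewrite divr_gt0.
have r2X : ((r / 2)%:E < diam [set: X])%E.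
  by rewrite (lt_trans _ rX)// lte_fin ltr_pdivrMr// ltr_pMr// ltr1n.
have lr0 : 0 < lambda * r by rewrite mulr_gt0.
have : ((2 * (lambda * r / 5))%:E < diam (ball x (r / 2)))%E.
  by apply: lt_le_trans (perf x _ r20 r2X); rewrite lte_fin; lra.
move=> /ereal_sup_gt[_ [y xy [z xz <-]]]; rewrite lte_fin => yz.
have := metric_triangle y x z; rewrite (metric_sym y x).
move: xy xz; rewrite !mem_ball => xy xz yxz.
have [xy'|xy'] := ltP (lambda * r / 5) (mdist x y); first by exists y; rewrite xy' xy.
by exists z; rewrite xz andbT; lra.
Qed.

End uniformly_perfect.

(** * Averages and precise representatives of cutoff functions *)

Section cutoff.
Context {R : realType} {d : measure_display} {X : borelMetricType R d}.
Variables (mu : {measure set X -> \bar R}) (D : R).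
Hypothesis muD : doubling_with D mu.
Variables (f phi : X -> R) (z : X) (s t : R).
Hypothesis mf : measurable_fun setT f.
Hypothesis fphi : f = phi %[ae mu].
Hypothesis phiC : cutoff_function (ball z s) (ball z t) phi.
Local Notation vol := (ball_volume mu).

Lemma average_cutoff1 y u : 0 < u -> ball y u `<=` ball z s ->
  average mu (ball y u) f = 1.
Proof.
move=> u0 yz; have [_ _ phi1 _ _] := phiC.
rewrite /average /Rintegral (ae_eq_integral (cst 1%E)) ?integral_cst//.
- rewrite mul1e -/(ball_volume mu y u) mulVf// gt_eqF//; exact: (vol_gt0 muD).
- exact: measurable_ball.
- exact: measurable_ball.
- by apply/measurable_EFinP; exact: measurable_funTS.
- apply: filterS fphi => x /(_ I) fx yx /=.
  by rewrite fx phi1//; exact: yz.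
Qed.

(** Every ball containing [x] of radius at most half of [s - mdist z x] stays inside [ball z s],
    where [f] is almost everywhere 1. The equality holds at every point of the ball, so it can be
    integrated against a [nu] that charges [mu]-null sets. *)
Lemma precise_representative_cutoff1 x : ball z s x -> precise_representative mu f x = 1%E.
Proof.
rewrite mem_ball => zx.
have e0 : 0 < (s - mdist z x) / 2 by rewrite divr_gt0// subr_gt0.
have avg1 y u : 0 < u <= (s - mdist z x) / 2 -> ball y u x ->
    `|average mu (ball y u) f - 1| <= 0.
  move=> /andP[u0 ue] yx; rewrite average_cutoff1// ?subrr ?normr0//; apply: sub_ball.
  have := metric_triangle z x y; move: yx; rewrite mem_ball (metric_sym y x).
  by move: (mdist x y) (mdist z y) (mdist z x) zx ue => a b c; lra.
have := precise_representative_close e0 avg1.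
case: (precise_representative _ _ _) => [v| |]//=.
by rewrite lee_fin normr_le0 subr_eq0 => /eqP ->.
Qed.

(** Almost everywhere [f] is at most the indicator of [ball z t], and the disjoint [ball w u] takes
    its share of the volume of [ball z r]. *)
Lemma average_cutoff_le r w u : 0 < t -> 0 < u -> 0 < r ->
  ball z t `<=` ball z r -> ball w u `<=` ball z r -> ball z t `&` ball w u `<=` set0 ->
  average mu (ball z r) f <= 1 - vol w u / vol z r.
Proof.
move=> t0 u0 r0 zt wu ztwu; have [_ _ phi1 phi0 phi01] := phiC.
have mB := measurable_ball z r.
have mfB : measurable_fun (ball z r) f by exact: measurable_funTS.
have vr0 : 0 < vol z r by exact: (vol_gt0 muD).
have fle : (\int[mu]_(y in ball z r) `|f y|%:E <= (vol z t)%:E)%E.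
  have ztr : ball z t `&` ball z r = ball z t by exact/setIidPl.
  rewrite -(mu_ball muD z t0) -[in leRHS]ztr -integral_indic//; last first.
    exact: measurable_ball.
  apply: ae_ge0_le_integral => //.
  - by apply/measurable_EFinP; exact: measurableT_comp.
  - by apply/measurable_EFinP; apply: measurable_indic; exact: measurable_ball.
  apply: filterS fphi => x /(_ I) -> _; rewrite lee_fin.
  have /andP[p0 p1] := phi01 x; rewrite ger0_norm// indicE.
  have [xt|xt] := pselect (ball z t x); first by rewrite mem_set.
  by rewrite phi0.
have ifB : mu.-integrable (ball z r) (EFin \o f).
  apply/integrableP; split; first exact/measurable_EFinP.
  by rewrite (le_lt_trans fle)// ltry.
have intf : \int[mu]_(y in ball z r) f y <= vol z t.
  rewrite (le_trans (ler_norm _))// (le_trans (le_normr_Rintegral mB ifB))//.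
  rewrite -lee_fin /Rintegral fineK// ge0_fin_numE ?integral_ge0//.
  by rewrite (le_lt_trans fle)// ltry.
have vtu : vol z t + vol w u <= vol z r.
  rewrite -lee_fin EFinD -!(mu_ball muD)// -measureU//; try exact: measurable_ball.
    apply: le_measure; rewrite ?inE//; last by rewrite subUset.
    by apply: measurableU; exact: measurable_ball.
  exact/seteqP.
rewrite /average -/(vol z r) mulrC ler_pdivrMr// mulrBl mul1r divfK ?gt_eqF//.
by rewrite (le_trans intf)// lerBrDr.
Qed.

End cutoff.

Section poincare_to_measure_bound.
Context {R : realType} {d : measure_display} {X : borelMetricType R d}.
Variables (mu nu : {measure set X -> \bar R}) (D : R).
Hypothesis muD : doubling_with D mu.
Variables (p q C sigma lambda cCap kCap bL bU cPsi bL' bU' cTheta : R).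
Variables (Psi Theta : X -> R -> R) (p1 : (1 <= p%:E)%E).
Variables (F : set (LspaceType mu p1)).
Variable Gamma : LspaceType mu p1 -> {finite_measure set X -> \bar R}.
Hypotheses (pq : p <= q) (C1 : 1 <= C).
Hypothesis Xlambda : uniformly_perfect_with X lambda.
Hypothesis PsiS : scale_function_with bL bU cPsi Psi.
Hypothesis ThetaS : scale_function_with bL' bU' cTheta Theta.
Hypothesis cap : capacity_upper_with cCap kCap F Gamma Psi.
Hypothesis trace : forall (x : X) (r : R) (f : LspaceType mu p1),
  0 < r -> (r%:E < diam [set: X])%E -> F f ->
  ((\int[nu]_(y in ball x r)
      (`|precise_representative mu f y - (average mu (ball x r) f)%:E| `^ q)) `^ q^-1
   <= (C * Theta x r)%:E * Gamma f (ball x (sigma * r)) `^ p^-1)%E.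
Local Notation vol := (ball_volume mu).

(** Chosen so that a cutoff at radius [cutoff_ratio * r] vanishes beyond [lambda * r / 10], half the
    distance given by [exists_far_point]; balls of that radius about the two points are then
    disjoint. *)
Definition cutoff_ratio : R := lambda / (10 * kCap).
Local Notation delta := cutoff_ratio.

Definition measure_constant (m n : nat) : R :=
  (D ^+ n) `^ q^-1 * (D ^+ m * C * cTheta * (cCap * D * cPsi * delta^-1 `^ bU) `^ p^-1).

Let p0 : 0 < p. Proof. by rewrite (lt_le_trans ltr01)// -lee_fin. Qed.
Let q0 : 0 < q. Proof. exact: lt_le_trans pq. Qed.
Let Psi0 x r : 0 < r -> 0 < Psi x r. Proof. by case: PsiS => _ _ _ + _; exact. Qed.
Let Theta0 x r : 0 < r -> 0 < Theta x r. Proof. by case: ThetaS => _ _ _ + _; exact. Qed.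

Lemma cutoff_ratio_gt0 : 0 < delta.
Proof.
have [_ k1 _] := cap; have [/andP[l0 _] _] := Xlambda.
by rewrite divr_gt0// mulr_gt0// (lt_trans ltr01).
Qed.

Lemma cutoff_ratio_le1 : delta <= 1.
Proof.
have [_ k1 _] := cap; have [/andP[l0 l2] _] := Xlambda.
by rewrite ler_pdivrMr; lra.
Qed.

(** On the small ball the precise representative of the cutoff is 1, while its average over
    [ball z r] is at most 1 - 1 / [D ^+ m]. The left side of the trace inequality thus controls the
    small ball, and the capacity bound controls the right side. *)
Lemma small_ball_bound z r m : 0 < r -> (r%:E < diam [set: X])%E ->
  15 <= 2 ^+ m * lambda ->
  (nu (ball z (delta * r)) `^ q^-1 <= (D ^+ m * (C * Theta z r) *
    (cCap * (vol z (delta * r) / Psi z (delta * r))) `^ p^-1)%:E)%E.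
Proof.
move=> r0 rX lm; set s := delta * r.
have [c1 k1 capE] := cap; have [/andP[l0 l2] _] := Xlambda; have [D1 _] := muD.
have k0 : 0 < kCap by exact: lt_trans k1.
have D0 : 0 < D by exact: lt_le_trans D1.
have Dm0 : 0 < D ^+ m by rewrite exprn_gt0.
have s0 : 0 < s by rewrite mulr_gt0// cutoff_ratio_gt0.
have sr : s <= r by rewrite ger_pMl// cutoff_ratio_le1.
have sX : (s%:E < diam [set: X])%E by rewrite (le_lt_trans _ rX)// lee_fin.
have [f [phi [Ff fphi phiC fE]]] := capE z s s0 sX.
have mf : measurable_fun setT (f : X -> R).
  exact: (@measurable_funPT _ _ X (measurableTypeR R)).
set t := kCap * s in phiC.
have tE : t = lambda * r / 10.
  by rewrite /t /s /cutoff_ratio; field; rewrite gt_eqF.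
have t0 : 0 < t by rewrite mulr_gt0.
have lr : lambda * r <= 2 * r by rewrite ler_wpM2r// ltW.
have [w /andP[zw wr]] := exists_far_point Xlambda z r0 rX.
have zt : ball z t `<=` ball z r by apply: sub_ball; rewrite mdistxx; lra.
have wt : ball w t `<=` ball z r by apply: sub_ball; lra.
have ztw : ball z t `&` ball w t `<=` set0.
  move=> y []; rewrite !mem_ball => zy wy.
  have := metric_triangle z y w; rewrite (metric_sym y w) => h.
  suff : mdist z w < mdist z w by rewrite ltxx.
  by move: (mdist z w) (mdist z y) (mdist w y) zw zy wy h => *; lra.
have vol0 : 0 < vol z r by exact: (vol_gt0 muD).
(* The ball about the far point has radius [lambda * r / 10]. It is compared with [ball z r] through
   [3 * r / 2 <= 2 ^+ m * (lambda * r / 10)], which is where 15 comes from. *)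
have avg1 : average mu (ball z r) f <= 1 - (D ^+ m)^-1.
  rewrite (le_trans (average_cutoff_le muD mf fphi phiC t0 t0 r0 zt wt ztw))//.
  rewrite lerD2l lerN2 ler_pdivlMr// ler_pdivrMl//.
  apply: (vol_comparable muD) => //; rewrite metric_sym tE.
  have : 15 * r <= 2 ^+ m * lambda * r by rewrite ler_wpM2r// ltW.
  by rewrite mulrA mulrA; lra.
have := trace z r0 rX Ff.
set I := integral _ _ _.
have Dmi0 : 0 < (D ^+ m)^-1 by rewrite invr_gt0.
have DmI : (((D ^+ m)^-1 `^ q)%:E * nu (ball z s) <= I)%E.
  have zsr : ball z s `&` ball z r = ball z s.
    by apply/setIidPl; apply: sub_ball; rewrite mdistxx add0r.
  rewrite -zsr -integral_indic; [|exact: measurable_ball..].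
  rewrite -ge0_integralZl_EFin ?powR_ge0//; last 2 first.
  - exact: measurable_ball.
  - by apply/measurable_EFinP; apply: measurable_indic; exact: measurable_ball.
  apply: ge0_le_integralW => y yr; first by rewrite mule_ge0// lee_fin ?powR_ge0.
  have [ys|ys] := pselect (ball z s y); last first.
    by rewrite indicE memNset// mule0 poweR_ge0.
  rewrite indicE mem_set// mule1 (precise_representative_cutoff1 muD mf fphi phiC)//.
  rewrite -EFinB abse_EFin poweR_EFin lee_fin; apply: ge0_ler_powR.
  - exact: ltW.
  - by rewrite nnegrE ltW.
  - by rewrite nnegrE.
  - by rewrite (le_trans _ (ler_norm _))// lerBrDl -lerBrDr.
have vs0 : 0 < vol z s by exact: (vol_gt0 muD).
have Ps0 : 0 < Psi z s by exact: Psi0.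
have CT0 : 0 <= C * Theta z r 
  by apply: mulr_ge0; [exact: le_trans C1|exact/ltW/Theta0].
have cc0 : 0 <= cCap * (vol z s / Psi z s).
  by apply: mulr_ge0; [exact: le_trans (ltW c1)|rewrite divr_ge0// ltW].
have GX : (Gamma f (ball z (sigma * r)) <= (cCap * (vol z s / Psi z s))%:E)%E.
  apply: (@le_trans _ _ (Gamma f [set: X])).
    by apply: le_measure; rewrite ?inE//; exact: measurable_ball.
  by rewrite (le_trans fE)// (mu_ball muD z s0) -!EFinM.
move=> /le_trans IG.
rewrite -mulrA EFinM -lee_pdivrMl//.
have -> : ((D ^+ m)^-1%:E * nu (ball z s) `^ q^-1 =
    (((D ^+ m)^-1 `^ q)%:E * nu (ball z s)) `^ q^-1)%E.
  rewrite poweRM ?lee_fin ?powR_ge0// poweR_EFin powRVK ?gt_eqF//.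
  exact: ltW.
apply: (@le_trans _ _ (I `^ q^-1)%E).
  apply: gt0_ler_poweR => //; first by rewrite invr_ge0 ltW.
  - by rewrite in_itv/= leey mule_ge0// lee_fin powR_ge0.
  - by rewrite in_itv/= leey (le_trans _ DmI)// mule_ge0// lee_fin powR_ge0.
apply: IG; rewrite [leRHS]EFinM lee_wpmul2l ?lee_fin// -poweR_EFin.
apply: gt0_ler_poweR => //; first by rewrite invr_ge0 ltW.
- by rewrite in_itv/= leey measure_ge0.
- by rewrite in_itv/= leey andbT lee_fin.
Qed.

(** A net of at most [D ^+ n] balls of radius [cutoff_ratio * r] covers [ball x r], and
    [small_ball_bound] applies to each of them. *)
Lemma measure_bound_of_trace_poincare x r m n : 0 < r -> (r%:E < diam [set: X])%E ->
  15 <= 2 ^+ m * lambda -> 4 + delta <= 2 ^+ n * delta ->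
  (nu (ball x r) `^ q^-1 <= (measure_constant m n * Theta x r)%:E *
     (mu (ball x r) * (Psi x r)^-1%:E) `^ p^-1)%E.
Proof.
move=> r0 rX lm nd; set s := delta * r.
have d0 := cutoff_ratio_gt0; have [c1 _ _] := cap; have [D1 _] := muD.
have [_ _ cT1 _ ThetaC] := ThetaS; have [_ bU0 cP1 _ PsiC] := PsiS.
have s0 : 0 < s by rewrite mulr_gt0.
have sr : s <= r by rewrite ger_pMl// cutoff_ratio_le1.
have D0 : 0 < D by exact: lt_le_trans D1.
have cT0 : 0 < cTheta by exact: lt_le_trans cT1.
have cP0 : 0 < cPsi by exact: lt_le_trans cP1.
have [C0 cC0] : 0 < C /\ 0 < cCap by split; apply: lt_le_trans ltr01 _ => //; exact: ltW.
have nds : 4 * r + s <= 2 ^+ n * s by rewrite /s mulrA -mulrDl ler_pM2r.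
have [l [sl lr lcov ln]] := exists_net muD x s0 r0 nds.
have vx0 : 0 < vol x r by exact: (vol_gt0 muD).
have Px0 : 0 < Psi x r by exact: Psi0.
have Tx0 : 0 < Theta x r by exact: Theta0.
rewrite (mu_ball muD x r0) -(EFinM (vol x r)).
rewrite poweR_EFin -EFinM.
(* The bound of [small_ball_bound] once [Theta], [Psi] and the volume at the net point are replaced
   by their values at [x], so that it is the same for the whole net. *)
set b := D ^+ m * C * cTheta * (cCap * D * cPsi * delta^-1 `^ bU) `^ p^-1 *
  (Theta x r * (vol x r / Psi x r) `^ p^-1).
have b0 : 0 <= b.
  by rewrite /b !mulr_ge0 ?powR_ge0 ?exprn_ge0 ?(ltW D0) ?(ltW C0) ?(ltW cT0) ?(ltW Tx0).
have nuz z : z \in l -> (nu (ball z s) <= (b `^ q)%:E)%E.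
  move=> /lr xz; have zs := small_ball_bound z r0 rX lm.
  suff : (nu (ball z s) `^ q^-1 <= b%:E)%E.
    move=> h; rewrite -poweR_EFin.
    rewrite -[leLHS]poweRe1// -(mulVf (lt0r_neq0 q0)) poweRrM.
    apply: gt0_ler_poweR h; rewrite ?(ltW q0) ?in_itv/= ?leey ?poweR_ge0//.
    by rewrite andbT lee_fin.
  apply: (le_trans zs); rewrite lee_fin -/s.
  have Tz : Theta z r <= cTheta * Theta x r.
    have zz : ball z r `&` ball x r !=set0 by exists z; split => //; rewrite mem_ball mdistxx.
    have /andP[+ _] := ThetaC x z r r r0 (lexx r) zz.
    by rewrite divff ?gt_eqF// powR1 mulr1 ler_pdivlMr ?Theta0// ler_pdivrMl.
  have Pz : (Psi z s)^-1 <= cPsi * delta^-1 `^ bU / Psi x r.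
    have zz : ball z s `&` ball x r !=set0 by exists z; split => //; rewrite mem_ball mdistxx.
    have /andP[_] := PsiC x z s r s0 sr zz.
    rewrite (_ : r / s = delta^-1); last by rewrite /s; field; rewrite !gt_eqF.
    by rewrite ler_pdivlMr// mulrC.
  have vz : vol z s <= D * vol x r.
    rewrite -(expr1 D); apply: (vol_comparable muD) => //.
    by move: xz; rewrite mem_ball expr1; lra.
  have Ps0 : 0 < Psi z s by exact: Psi0.
  have vs0 : 0 < vol z s by exact: (vol_gt0 muD).
  have vP : vol z s / Psi z s <= D * vol x r * (cPsi * delta^-1 `^ bU / Psi x r).
    by rewrite ler_pM ?invr_ge0 ?(ltW vs0) ?(ltW Ps0).
  have -> : b = D ^+ m * (C * (cTheta * Theta x r)) *
      (cCap * (D * vol x r * (cPsi * delta^-1 `^ bU / Psi x r))) `^ p^-1.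
    rewrite (_ : cCap * _ = cCap * D * cPsi * delta^-1 `^ bU * (vol x r / Psi x r)); last by ring.
    rewrite (powRM p^-1 (x := cCap * D * cPsi * delta^-1 `^ bU)); first by rewrite /b; ring.
      by rewrite !mulr_ge0 ?powR_ge0// ltW.
    by rewrite divr_ge0// ltW.
  have Tz0 : 0 < Theta z r by exact: Theta0.
  apply: ler_pM.
  - by rewrite !mulr_ge0 ?exprn_ge0// ltW.
  - exact: powR_ge0.
  - by rewrite ler_wpM2l ?exprn_ge0 ?(ltW D0)// ler_wpM2l// ltW.
  - apply: ge0_ler_powR; first by rewrite invr_ge0 ltW.
    + by rewrite nnegrE !mulr_ge0 ?invr_ge0// ltW.
    + by rewrite nnegrE !mulr_ge0 ?invr_ge0 ?powR_ge0// ltW.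
    + by rewrite ler_wpM2l// ltW.
have nux : (nu (ball x r) <= (D ^+ n * b `^ q)%:E)%E.
  apply: (le_trans (measure_le_sum nu (fun z => measurable_ball z s) (measurable_ball x r) lcov)).
  apply: (@le_trans _ _ (\sum_(z <- l) (b `^ q)%:E)%E).
    by rewrite big_seq [leRHS]big_seq; apply: lee_sum.
  rewrite sumEFin lee_fin big_const_seq count_predT iter_addr_0 -mulr_natl.
  by rewrite ler_wpM2r ?powR_ge0.
apply: (@le_trans _ _ ((D ^+ n * b `^ q)%:E `^ q^-1)%E).
  apply: gt0_ler_poweR => //; first by rewrite invr_ge0 ltW.
  - by rewrite in_itv/= leey measure_ge0.
  - by rewrite in_itv/= leey lee_fin mulr_ge0 ?powR_ge0 ?exprn_ge0// ltW.
rewrite poweR_EFin lee_fin powRM ?powR_ge0 ?exprn_ge0 ?(ltW D0)// powRVK ?gt_eqF//.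
by rewrite /measure_constant le_eqVlt; apply/orP; left; apply/eqP; rewrite /b; ring.
Qed.

End poincare_to_measure_bound.

(** * Choice of uniform constants and conclusion *)

Lemma le_exp2 (R : realType) (a : R) : exists n, a <= 2 ^+ n.
Proof.
exists (Num.truncn a).+1; apply: (le_trans (ltW (truncnS_gt _))).
by rewrite -natrX ler_nat ltnW// ltn_expl.
Qed.

Theorem theorem3p1 (R : realType) (p q : R) (p1 : (1 <= p%:E)%E) (pq : p <= q) :
  (forall (d : measure_display) (X : borelMetricType R d)
      (mu nu : {measure set X -> \bar R}) (S : penergy_structure mu p1)
      (Theta : X -> R -> R),
    standing_assumptions mu -> doubling mu -> uniformly_perfect X ->
    scale_function Theta ->
    (exists2 K, 1 <= K & trace_measure_bound S q Theta nu K) <->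
    (exists C sigma, [/\ 1 <= C, 1 <= sigma
                       & trace_poincare S q Theta nu C sigma])) /\
  (* the equivalence is quantitative *)
  (forall D lambda bL bU cPsi bL' bU' cTheta cPI sPI cCap kCap : R,
    let admissible (d : measure_display) (X : borelMetricType R d)
        (mu : {measure set X -> \bar R}) (S : penergy_structure mu p1)
        (Theta : X -> R -> R) : Prop :=
      [/\ [/\ standing_assumptions mu, doubling_with D mu
            & uniformly_perfect_with X lambda],
          scale_function_with bL bU cPsi (energy_scale S),
          scale_function_with bL' bU' cTheta Theta,
          poincare_with cPI sPI (energy_dom S) (energy S) (energy_scale S)
        & capacity_upper_with cCap kCap
            (energy_dom S) (energy S) (energy_scale S)] in
    (forall K : R, 1 <= K ->
      exists C sigma, [/\ 1 <= C, 1 <= sigma &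
        forall (d : measure_display) (X : borelMetricType R d)
            (mu nu : {measure set X -> \bar R}) (S : penergy_structure mu p1)
            (Theta : X -> R -> R),
          admissible d X mu S Theta ->
          trace_measure_bound S q Theta nu K ->
          trace_poincare S q Theta nu C sigma]) /\
    (forall C sigma : R, 1 <= C -> 1 <= sigma ->
      exists2 K, 1 <= K &
        forall (d : measure_display) (X : borelMetricType R d)
            (mu nu : {measure set X -> \bar R}) (S : penergy_structure mu p1)
            (Theta : X -> R -> R),
          admissible d X mu S Theta ->
          trace_poincare S q Theta nu C sigma ->
          trace_measure_bound S q Theta nu K)).
Proof.
have p1' : 1 <= p by rewrite -lee_fin.
(* In [fwd] and [bwd] the new constants are fixed before the space, the measures and the energy
   structure are introduced. The plain equivalence then follows by unpacking the existential
   constants. *)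
have fwd (D lambda bL bU cPsi bL' bU' cTheta cPI sPI cCap kCap K : R) : 1 <= K ->
    exists C sigma, [/\ 1 <= C, 1 <= sigma &
      forall (d : measure_display) (X : borelMetricType R d)
          (mu nu : {measure set X -> \bar R}) (S : penergy_structure mu p1)
          (Theta : X -> R -> R),
        doubling_with D mu ->
        scale_function_with bL bU cPsi (energy_scale S) ->
        scale_function_with bL' bU' cTheta Theta ->
        poincare_with cPI sPI (energy_dom S) (energy S) (energy_scale S) ->
        trace_measure_bound S q Theta nu K -> trace_poincare S q Theta nu C sigma].
  move=> K1; have [n nP] := le_exp2 (16 * sPI + 1).
  exists (Num.max 1 (trace_constant D p q cPI K bU cPsi bL' cTheta n)).
  exists (Num.max 1 (1 + 4 * sPI)); split; [by rewrite le_max lexx..|].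
  move=> d X mu nu S Theta muD PsiS ThetaS [cPI1 sPI1 PI] T1 x r f r0 rX Sf.
  have mf : measurable_fun setT (f : X -> R).
    exact: (@measurable_funPT _ _ X (measurableTypeR R)).
  have := trace_poincare_of_measure_bound muD p1' pq cPI1 sPI1 K1 PsiS ThetaS mf
    (fun x r r0 => PI x r f r0 Sf) T1 x r0 rX nP.
  rewrite [Num.max _ (1 + _)]max_r; last by lra.
  move=> /le_trans; apply; rewrite lee_wpmul2r ?poweR_ge0// lee_fin ler_wpM2r//.
    by rewrite ltW//; have [_ _ _ + _] := ThetaS; exact.
  by rewrite le_max lexx orbT.
have bwd (D lambda bL bU cPsi bL' bU' cTheta cCap kCap C sigma : R) : 1 <= C ->
    exists2 K, 1 <= K &
      forall (d : measure_display) (X : borelMetricType R d)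
          (mu nu : {measure set X -> \bar R}) (S : penergy_structure mu p1)
          (Theta : X -> R -> R),
        doubling_with D mu -> uniformly_perfect_with X lambda ->
        scale_function_with bL bU cPsi (energy_scale S) ->
        scale_function_with bL' bU' cTheta Theta ->
        capacity_upper_with cCap kCap (energy_dom S) (energy S) (energy_scale S) ->
        trace_poincare S q Theta nu C sigma -> trace_measure_bound S q Theta nu K.
  (* No space is given yet, so [lambda] and [cutoff_ratio] are not known to be positive here.
     Division being total, the exponents can be chosen anyway, and positivity is used only to clear
     denominators later. *)
  move=> C1; have [m mP] := le_exp2 (15 / lambda).
  have [n nP] := le_exp2 ((4 + cutoff_ratio lambda kCap) / cutoff_ratio lambda kCap).
  exists (Num.max 1 (measure_constant D p q C lambda cCap kCap bU cPsi cTheta m n)).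
    by rewrite le_max lexx.
  move=> d X mu nu S Theta muD Xl PsiS ThetaS cap T2 x r r0 rX.
  have [/andP[l0 _] _] := Xl.
  have mP' : 15 <= 2 ^+ m * lambda by rewrite -ler_pdivrMr.
  have nP' : 4 + cutoff_ratio lambda kCap <= 2 ^+ n * cutoff_ratio lambda kCap.
    by rewrite -ler_pdivrMr//; exact: (cutoff_ratio_gt0 Xl cap).
  apply: (le_trans (measure_bound_of_trace_poincare muD pq C1 Xl PsiS ThetaS cap T2 x r0 rX mP' nP')).
  rewrite lee_wpmul2r ?poweR_ge0// lee_fin ler_wpM2r//.
    by rewrite ltW//; have [_ _ _ + _] := ThetaS; exact.
  by rewrite le_max lexx orbT.
split.
  move=> d X mu nu S Theta _ [D muD] [lambda Xl] [bL' [bU' [cT ThetaS]]].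
  have [bL [bU [cP PsiS]]] := energy_scaleP S.
  have [cPI [sPI PI]] := energy_poincare S.
  have [cCap [kCap cap]] := energy_capacity S.
  split.
    move=> [K K1 T1].
    have [C [sigma [C1 s1 CS]]] := fwd D lambda bL bU cP bL' bU' cT cPI sPI cCap kCap K K1.
    by exists C, sigma; split => //; exact: (CS _ _ _ _ _ _ muD PsiS ThetaS PI T1).
  move=> [C [sigma [C1 _ T2]]].
  have [K K1 KS] := bwd D lambda bL bU cP bL' bU' cT cCap kCap C sigma C1.
  by exists K => //; exact: (KS _ _ _ _ _ _ muD Xl PsiS ThetaS cap T2).
move=> D lambda bL bU cP bL' bU' cT cPI sPI cCap kCap admissible; split.
  move=> K K1.
  have [C [sigma [C1 s1 CS]]] := fwd D lambda bL bU cP bL' bU' cT cPI sPI cCap kCap K K1.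
  exists C, sigma; split => // d X mu nu S Theta [[_ muD _] PsiS ThetaS PI _].
  exact: CS muD PsiS ThetaS PI.
move=> C sigma C1 _.
have [K K1 KS] := bwd D lambda bL bU cP bL' bU' cT cCap kCap C sigma C1.
exists K => // d X mu nu S Theta [[_ muD Xl] PsiS ThetaS _ cap].
exact: KS muD Xl PsiS ThetaS cap.
Qed.
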